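(* Suppose that $f,g\in H^1(\mathbb{C}_+)$, that $|f|=|g|$ almost everywhere on $i\mathbb{R}$ (in the sense of boundary values), and that $|f|=|g|$ on $1+i\mathbb{R}$. Then $f=cg$ for some unimodular constant $c$.
   Context: $\mathbb{C}_+=\{s\in\mathbb{C}:\operatorname{Re}s>0\}$ is the right half-plane, and $H^1(\mathbb{C}_+)$ is the Hardy space of analytic functions $f$ on $\mathbb{C}_+$ with $\sup_{x>0}\int_{\mathbb{R}}|f(x+iy)|\,dy<\infty$. *)

(* Defs.v *)
From HB Require Import structures.
From mathcomp Require Import all_boot all_order all_algebra.
From mathcomp Require Import all_classical all_reals all_analysis.
From mathcomp Require Import complex.
Import Order.TTheory GRing.Theory Num.Theory.
Import numFieldNormedType.Exports.
Local Open Scope ring_scope.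
Local Open Scope classical_set_scope.

Set Implicit Arguments.
Unset Strict Implicit.
Unset Printing Implicit Defensive.

Definition cabs (R : realType) (z : R[i]) : R :=
  Num.sqrt (complex.Re z ^+ 2 + complex.Im z ^+ 2).

Definition rhp (R : realType) : set R[i] := [set z | 0 < complex.Re z].

Definition holomorphic_rhp (R : realType) (f : R[i] -> R[i]) : Prop :=
  forall z : R[i], 0 < complex.Re z -> derivable (f : R[i]^o -> R[i]^o) z 1.

Definition H1_rhp (R : realType) (f : R[i] -> R[i]) : Prop :=
  holomorphic_rhp f /\
  exists M : R, forall x : R, 0 < x ->
    (\int[@lebesgue_measure R]_(y in [set: R]) (cabs (f (Complex x y)))%:E
      <= M%:E)%E.

(* Main.v *)
(** Schwarz reflection in the line [Re z = s] turns [|f| = |g|] on that line into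
    [f(z) conj f(2s - conj z) = g(z) conj g(2s - conj z)] on the strip [0 < Re z < 2s].
    For [s = 1], letting [Re z] tend to [0] gives [|f| = |g|] at the points of [Re z = 2]
    facing nonzero boundary values, hence on the whole line, because an [H^1] function whose
    boundary values vanish on an interval is zero.  The reflections for [s = 1] and [s = 2]
    together make [f / g] periodic with period [2]; so [f - c g] vanishes on an arithmetic
    progression [z0 + 2 n] for some unimodular [c].  As [sum 1/n] diverges, this contradicts the
    Blaschke condition unless [f = c g].

    The analytic tools come from Goursat's theorem: applied to
    [(k z - k w) / ((z - w) (z - w'))], with [w'] the mirror image of [w] in a vertical line, it
    gives the Poisson inequality on that line, whence the maximum principle and Blaschke bounds
    for the half-plane.  Boundary uniqueness is reduced to bounded functions by
    dividing [g] by [1 + V], where [Re V] is a Poisson majorant of [|g|]. *)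
Require Import Defs.
From HB Require Import structures.
From mathcomp Require Import all_boot all_order all_algebra.
From mathcomp Require Import all_classical all_reals all_analysis measurable_realfun.
From mathcomp Require Import complex.
From mathcomp Require Import ring lra.
Import Order.TTheory GRing.Theory Num.Theory.
Import numFieldNormedType.Exports.
Local Open Scope ring_scope.
Local Open Scope classical_set_scope.

Set Implicit Arguments.
Unset Strict Implicit.
Unset Printing Implicit Defensive.

(** No boundary theory is used: estimates are made on lines [Re z = x0] with [x0 > 0], where the
    functions are continuous, and the boundary is reached through limits. In the reflection identity
    the limit at a fixed height needs only the radial limits at that height.

    An [H^1] function is bounded only in the mean, while Blaschke bounds need bounded functions. The
    link is the integral [K w] of [g] over the segment from [w] to [w + i s]: it is bounded, its
    derivative is [i (g w - g (w + i s))], and a Schwarz lemma bounds that derivative. Hence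
    translates of [g] to the right are bounded.

    Dividing out zeros creates isolated singularities. They are not removed by redefining the
    function: they are kept in a finite list of exceptional points, which the maximum principle
    tolerates.

    Poisson kernels stay unnormalised. In the maximum principle the mass cancels; elsewhere the
    lower bound [1 / a] for a mass that is really [pi / a] costs only a constant factor.

    The quotient [f / g] may have poles, so periodicity is stated in cross-multiplied form. *)

Section Cabs.
Context {R : realType}.
Implicit Types z w : R[i].

(** * Modulus, conjugation, real and imaginary parts *)

Lemma cabs_normc z : cabs z = Normc.normc z.
Proof. by case: z. Qed.

Lemma normcE_cabs z : `|z| = (cabs z)%:C%C.
Proof. exact: normc_def. Qed.

Lemma cabs_ge0 z : 0 <= cabs z.
Proof. exact: sqrtr_ge0. Qed.

Lemma cabs0 : cabs (0 : R[i]) = 0.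
Proof. by rewrite cabs_normc Normc.normc0. Qed.

Lemma cabs1 : cabs (1 : R[i]) = 1.
Proof. by rewrite cabs_normc Normc.normc1. Qed.

Lemma cabs_eq0 z : (cabs z == 0) = (z == 0).
Proof.
apply/eqP/eqP => [|->]; last exact: cabs0.
by rewrite cabs_normc => /Normc.eq0_normc.
Qed.

Lemma cabs_gt0 z : (0 < cabs z) = (z != 0).
Proof. by rewrite lt_def cabs_ge0 andbT cabs_eq0. Qed.

Lemma cabsM z w : cabs (z * w) = cabs z * cabs w.
Proof. by rewrite !cabs_normc Normc.normcM. Qed.

Lemma cabsV z : cabs z^-1 = (cabs z)^-1.
Proof. by rewrite !cabs_normc Normc.normcV. Qed.

Lemma cabsX z n : cabs (z ^+ n) = cabs z ^+ n.
Proof. by elim: n => [|n IH]; rewrite ?expr0 ?cabs1// !exprS cabsM IH. Qed.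

Lemma cabsN z : cabs (- z) = cabs z.
Proof. by rewrite !cabs_normc normcN. Qed.

Lemma cabsC z w : cabs (z - w) = cabs (w - z).
Proof. by rewrite -cabsN opprB. Qed.

Lemma ler_cabsD z w : cabs (z + w) <= cabs z + cabs w.
Proof. by rewrite !cabs_normc le_normcD. Qed.

Lemma ler_cabsB z w : cabs (z - w) <= cabs z + cabs w.
Proof. by rewrite -(cabsN w) ler_cabsD. Qed.

Lemma lerB_cabsD z w : cabs z - cabs w <= cabs (z + w).
Proof. by have := ler_cabsB (z + w) w; rewrite addrK; lra. Qed.

Lemma lerB_cabsB z w : cabs z - cabs w <= cabs (z - w).
Proof. by rewrite -(cabsN w) lerB_cabsD. Qed.

Lemma cabs_conj z : cabs (conjc z) = cabs z.
Proof. by case: z => a b; rewrite /cabs /= sqrrN. Qed.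

Lemma sqr_cabs z : cabs z ^+ 2 = complex.Re z ^+ 2 + complex.Im z ^+ 2.
Proof. by rewrite sqr_sqrtr// addr_ge0// sqr_ge0. Qed.

Lemma cabs_real (x : R) : cabs x%:C%C = `|x|.
Proof. by rewrite /cabs /= expr0n /= addr0 sqrtr_sqr. Qed.

Lemma cabs_i : cabs (Complex 0 1 : R[i]) = 1.
Proof. by rewrite /cabs /= expr0n expr1n add0r sqrtr1. Qed.

Lemma ler_Re_cabs z : `|complex.Re z| <= cabs z.
Proof. by rewrite -sqrtr_sqr ler_sqrt ?addr_ge0 ?sqr_ge0// lerDl sqr_ge0. Qed.

Lemma ler_Im_cabs z : `|complex.Im z| <= cabs z.
Proof. by rewrite -sqrtr_sqr ler_sqrt ?addr_ge0 ?sqr_ge0// lerDr sqr_ge0. Qed.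

Lemma ler_cabs_ReIm z : cabs z <= `|complex.Re z| + `|complex.Im z|.
Proof.
rewrite -(ler_pXn2r (n := 2))// ?nnegrE ?cabs_ge0 ?addr_ge0// sqr_cabs.
by rewrite sqrrD !real_normK ?num_real// lerD2r lerDl mulrn_wge0 ?mulr_ge0.
Qed.

Lemma conjcM z w : conjc (z * w) = conjc z * conjc w.
Proof. exact: rmorphM. Qed.

Lemma conjcB z w : conjc (z - w) = conjc z - conjc w.
Proof. exact: rmorphB. Qed.

Lemma mulc_conj z : z * conjc z = (cabs z ^+ 2)%:C%C.
Proof. by rewrite -sqr_normc normcE_cabs rmorphXn. Qed.

Lemma ReD z w : complex.Re (z + w) = complex.Re z + complex.Re w.
Proof. by case: z; case: w. Qed.

Lemma ImD z w : complex.Im (z + w) = complex.Im z + complex.Im w.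
Proof. by case: z; case: w. Qed.

Lemma ReB z w : complex.Re (z - w) = complex.Re z - complex.Re w.
Proof. by case: z; case: w. Qed.

Lemma ImB z w : complex.Im (z - w) = complex.Im z - complex.Im w.
Proof. by case: z; case: w. Qed.

Lemma Re_conjc z : complex.Re (conjc z) = complex.Re z.
Proof. by case: z. Qed.

End Cabs.

(** * Complex differentiability with real epsilons and deltas *)

Section Differentiability.
Context {R : realType}.
Implicit Types (F G : R[i] -> R[i]) (z w : R[i]).

(** The scalars are complex, so the increments along the direction [1] run through all complex
    numbers: this is complex differentiability. *)
Definition cdiff F z := derivable (F : R[i]^o -> R[i]^o) z 1.

(** The norm of [R[i]] takes values in [R[i]], so radii of balls are positive complex numbers, hence
    real; here they become elements of [R]. *)
Lemma nbhs_cabsP z (P : set R[i]) :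
  nbhs (z : R[i]^o) P <-> exists2 d, 0 < d & forall w, cabs (w - z) < d -> P w.
Proof.
split=> [/nbhs_ballP[e /= e0 zP]|[d d0 zP]].
  have eR : e = (complex.Re e)%:C%C by rewrite RRe_real// gtr0_real.
  exists (complex.Re e); first by rewrite -ltcR -eR.
  by move=> w wz; apply: zP; rewrite /ball /= normcE_cabs eR ltcR cabsC.
apply/nbhs_ballP; exists (d%:C%C); first by rewrite /= ltcR.
by move=> w; rewrite /ball /= normcE_cabs ltcR cabsC => /zP.
Qed.

Lemma cdiffP F z : cdiff F z <-> exists D, forall e, 0 < e ->
  exists2 d, 0 < d & forall w, cabs (w - z) < d ->
    cabs (F w - F z - D * (w - z)) <= e * cabs (w - z).
Proof.
rewrite /cdiff /derivable; split.
  move=> /cvg_ex[D /= /cvgrPdist_le FD]; exists D => e e0.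
  have [|d /= d0 dF] := (nbhs_cabsP 0 (fun h => h != 0 ->
     `|D - h^-1 *: (F (h *: 1 + z) - F z)| <= e%:C%C)).1.
    by have := FD e%:C%C; rewrite ltcR => /(_ e0).
  exists d => // w wz.
  have [->|wNz] := eqVneq w z; first by rewrite !subrr mulr0 subr0 cabs0 mulr0.
  have wz0 : w - z != 0 by rewrite subr_eq0.
  have := dF (w - z); rewrite subr0 => /(_ wz wz0).
  rewrite normcE_cabs lecR /GRing.scale/= mulr1 subrK => h.
  rewrite (_ : _ - _ = (w - z) * - (D - (w - z)^-1 * (F w - F z))); last by field.
  by rewrite cabsM cabsN mulrC ler_wpM2r// cabs_ge0.
move=> [D FD]; apply/cvg_ex; exists D; apply/cvgrPdist_le => /= e e0.
have eR : e = (complex.Re e)%:C%C by rewrite RRe_real// gtr0_real.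
have [|d d0 dF] := FD (complex.Re e); first by rewrite -ltcR -eR.
apply/nbhs_cabsP; exists d => // h; rewrite subr0 => hd h0.
have := dF (h + z); rewrite addrK => /(_ hd).
rewrite eR normcE_cabs lecR /GRing.scale/= mulr1 => {}hd.
rewrite -(ler_pM2r (_ : 0 < cabs h)) ?cabs_gt0//.
rewrite -cabsM -cabsN (_ : - _ = F (h + z) - F z - D * h)//.
by field.
Qed.

Lemma cdiff_cst c z : cdiff (fun=> c) z.
Proof. exact: derivable_cst. Qed.

Lemma cdiff_id z : cdiff id z.
Proof. exact: derivable_id. Qed.

Lemma cdiffD F G z : cdiff F z -> cdiff G z -> cdiff (fun w => F w + G w) z.
Proof. exact: derivableD. Qed.

Lemma cdiffB F G z : cdiff F z -> cdiff G z -> cdiff (fun w => F w - G w) z.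
Proof. exact: derivableB. Qed.

Lemma cdiffM F G z : cdiff F z -> cdiff G z -> cdiff (fun w => F w * G w) z.
Proof. exact: derivableM. Qed.

Lemma cdiffV F z : F z != 0 -> cdiff F z -> cdiff (fun w => (F w)^-1) z.
Proof. exact: derivableV. Qed.

Lemma cdiff_div F G z : G z != 0 -> cdiff F z -> cdiff G z ->
  cdiff (fun w => F w / G w) z.
Proof. by move=> G0 Fz Gz; exact: (cdiffM Fz (cdiffV G0 Gz)). Qed.

Lemma cdiffX F n z : cdiff F z -> cdiff (fun w => F w ^+ n) z.
Proof.
by move=> Fz; elim: n => [|n IH]; [exact: cdiff_cst|
  under eq_fun do rewrite exprS; exact: (cdiffM Fz IH)].
Qed.

Lemma cdiff_comp F G z : cdiff G z -> cdiff F (G z) -> cdiff (fun w => F (G w)) z.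
Proof.
move=> /derivable1_diffP dG /derivable1_diffP dF; apply/derivable1_diffP.
exact: (differentiable_comp dG dF).
Qed.

Lemma cdiff_subr c z : cdiff (fun w => w - c) z.
Proof. by apply: cdiffB; [exact: cdiff_id|exact: cdiff_cst]. Qed.

Lemma cdiff_addr c z : cdiff (fun w => w + c) z.
Proof. by apply: cdiffD; [exact: cdiff_id|exact: cdiff_cst]. Qed.

(** For [c = 2 s] with [s] real, [c - conjc w] is the mirror image of [w] in the line [Re = s]. The
    two conjugations cancel, and the derivative is [- conjc D]. *)
Lemma cdiff_reflect F c z : cdiff F (c - conjc z) ->
  cdiff (fun w => conjc (F (c - conjc w))) z.
Proof.
move=> /cdiffP[D FD]; apply/cdiffP; exists (- conjc D) => e e0.
have [d d0 dF] := FD _ e0; exists d => // w wz.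
have E : c - conjc w - (c - conjc z) = - conjc (w - z) by rewrite conjcB; ring.
have := dF (c - conjc w); rewrite E cabsN cabs_conj => /(_ wz).
rewrite -[X in X <= _ -> _]cabs_conj [conjc (F _ - F _ - _)]conjcB.
by rewrite [conjc (F _ - F _)]conjcB conjcM rmorphN/= conjcK mulrN mulNr.
Qed.

Lemma cdiff_continuous F z : cdiff F z -> forall e, 0 < e ->
  exists2 d, 0 < d & forall w, cabs (w - z) < d -> cabs (F w - F z) < e.
Proof.
move=> /derivable1_diffP/differentiable_continuous + e e0.
move=> /cvgrPdist_lt/(_ e%:C%C); rewrite ltcR => /(_ e0)/nbhs_cabsP[d d0 dF].
by exists d => // w /dF; rewrite normcE_cabs ltcR cabsC.
Qed.

Lemma cdiff_lipschitz F z : cdiff F z -> exists B, exists2 d, 0 < d &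
  forall w, cabs (w - z) < d -> cabs (F w - F z) <= B * cabs (w - z).
Proof.
move=> /cdiffP[D] /(_ 1 ltr01)[d d0 dF]; exists (1 + cabs D); exists d => // w wz.
have := dF _ wz; have := ler_cabsD (F w - F z - D * (w - z)) (D * (w - z)).
by rewrite subrK cabsM; lra.
Qed.

End Differentiability.

Opaque cdiff.

(** * Integrals of complex-valued functions of a real variable *)

Section ComplexIntegral.
Context {R : realType}.
Notation mu := (@lebesgue_measure R).
Implicit Types (D : set (measurableTypeR R)) (h : R -> R[i]) (a b c t : R).

Definition cint D h : R[i] :=
  Complex (\int[mu]_(t in D) complex.Re (h t)) (\int[mu]_(t in D) complex.Im (h t)).

Definition cintegrable D h :=
  mu.-integrable D (EFin \o (fun t => complex.Re (h t))) /\
  mu.-integrable D (EFin \o (fun t => complex.Im (h t))).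

(** Serves as the constructor of [cintegrable] once that definition is opaque. *)
Lemma cintegrable_ReIm D h :
  mu.-integrable D (EFin \o (fun t => complex.Re (h t))) ->
  mu.-integrable D (EFin \o (fun t => complex.Im (h t))) -> cintegrable D h.
Proof. by []. Qed.

Lemma Re_cint D h : complex.Re (cint D h) = \int[mu]_(t in D) complex.Re (h t).
Proof. by []. Qed.

Lemma eq_cint D h h' : (forall t, D t -> h t = h' t) -> cint D h = cint D h'.
Proof.
by move=> hh; congr Complex; apply: eq_Rintegral => t /set_mem Dt; rewrite hh.
Qed.

Lemma eq_cintegrable D h h' : measurable D ->
  (forall t, D t -> h t = h' t) -> cintegrable D h -> cintegrable D h'.
Proof.
by move=> mD hh [h1 h2]; split; [apply: eq_integrable h1 | apply: eq_integrable h2] => //=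
  t /set_mem Dt /=; rewrite hh.
Qed.

Lemma cintegrableB D h h' : measurable D -> cintegrable D h -> cintegrable D h' ->
  cintegrable D (fun t => h t - h' t).
Proof.
move=> mD [h1 h2] [h1' h2']; split.
  have := integrableB mD h1 h1'; apply: eq_integrable => // t _ /=.
  by rewrite ReB EFinB.
have := integrableB mD h2 h2'; apply: eq_integrable => // t _ /=.
by rewrite ImB EFinB.
Qed.

Lemma cintegrableZ D h z : measurable D -> cintegrable D h ->
  cintegrable D (fun t => z * h t).
Proof.
case: z => x y mD [h1 h2]; split.
  have := integrableB mD (integrableZl mD x h1) (integrableZl mD y h2).
  by apply: eq_integrable => // t _ /=; case: (h t).
have := integrableD mD (integrableZl mD x h2) (integrableZl mD y h1).
by apply: eq_integrable => // t _ /=; case: (h t).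
Qed.

Lemma cintB D h h' : measurable D -> cintegrable D h -> cintegrable D h' ->
  cint D (fun t => h t - h' t) = cint D h - cint D h'.
Proof.
move=> mD [h1 h2] [h1' h2']; rewrite /cint; apply/eqP; rewrite eq_complex /=.
by rewrite -!RintegralB//; apply/andP; split; apply/eqP; apply: eq_Rintegral => t _;
  rewrite ?ReB ?ImB.
Qed.

Lemma cintZ D h z : measurable D -> cintegrable D h ->
  cint D (fun t => z * h t) = z * cint D h.
Proof.
case: z => x y mD [h1 h2]; rewrite /cint; apply/eqP; rewrite eq_complex /=.
have i1 u (v : R -> R) : mu.-integrable D (EFin \o v) ->
    mu.-integrable D (EFin \o (fun t => u * v t)).
  by move=> iv; exact: (integrableZl mD u iv).
rewrite -!RintegralZl// -RintegralB ?i1// -RintegralD ?i1//.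
by apply/andP; split; apply/eqP; apply: eq_Rintegral => t _; case: (h t).
Qed.

(* Rotate so that the integral becomes a nonnegative real number. *)
Lemma ler_cabs_cint D h (u : R -> R) : measurable D -> cintegrable D h ->
  mu.-integrable D (EFin \o u) -> (forall t, D t -> cabs (h t) <= u t) ->
  cabs (cint D h) <= \int[mu]_(t in D) u t.
Proof.
move=> mD ih iu hu; set I := cint D h.
have [I0|I0] := eqVneq I 0.
  rewrite I0 cabs0; apply: Rintegral_ge0 => t Dt.
  by apply: le_trans (hu t Dt); exact: cabs_ge0.
pose z := conjc I * (cabs I)^-1%:C%C.
have z1 : cabs z = 1.
  by rewrite cabsM cabs_conj cabs_real ger0_norm ?invr_ge0 ?cabs_ge0// divff// cabs_eq0.
have -> : cabs I = complex.Re (z * I).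
  rewrite /z mulrAC [_ * I]mulrC mulc_conj -rmorphM/=.
  by rewrite expr2 -mulrA divff ?mulr1// cabs_eq0.
rewrite /I -cintZ//=; have [iz _] := cintegrableZ z mD ih.
apply: le_Rintegral => // t Dt; apply: le_trans (hu _ Dt).
apply: (le_trans (ler_norm _)); apply: (le_trans (ler_Re_cabs _)).
by rewrite cabsM z1 mul1r.
Qed.

Lemma integrable_cst_itv a b (B : R) : mu.-integrable `[a, b] (EFin \o (fun=> B)).
Proof.
by apply: continuous_compact_integrable; [exact: segment_compact|
  apply: continuous_subspaceT => x; exact: cvg_cst].
Qed.

Lemma cintegrable_cst a b z : cintegrable `[a, b] (fun=> z).
Proof. by split; exact: integrable_cst_itv. Qed.

Lemma Rintegral_cst_itv a b (B : R) : a <= b -> \int[mu]_(t in `[a, b]) B = B * (b - a).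
Proof.
rewrite Rintegral_cst//= lebesgue_measure_itv/= lte_fin le_eqVlt.
by move=> /predU1P[->|->]; rewrite ?ltxx/= ?subrr.
Qed.

Lemma cint_cst a b z : a <= b -> cint `[a, b] (fun=> z) = z * (b - a)%:C%C.
Proof.
move=> ab; rewrite /cint !Rintegral_cst_itv//; case: z => x y.
by apply/eqP; rewrite eq_complex /= !mulr0 subr0 add0r !eqxx.
Qed.

Lemma ler_cabs_cint_itv a b h (B : R) : a <= b -> cintegrable `[a, b] h ->
  (forall t, a <= t <= b -> cabs (h t) <= B) -> cabs (cint `[a, b] h) <= B * (b - a).
Proof.
move=> ab ih hB; rewrite -(Rintegral_cst_itv _ ab).
by apply: ler_cabs_cint => //; exact: integrable_cst_itv.
Qed.

Lemma cintegrable_real D (u : R -> R) : mu.-integrable D (EFin \o u) ->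
  cintegrable D (fun t => (u t)%:C%C).
Proof. by move=> iu; split => //=; exact: integrable0. Qed.

Lemma cint_real D (u : R -> R) : cint D (fun t => (u t)%:C%C) = (\int[mu]_(t in D) u t)%:C%C.
Proof. by congr Complex; rewrite /Rintegral /= integral0. Qed.

Lemma Rintegral_itv_split a b c (f : R -> R) : a <= b -> b <= c ->
  mu.-integrable `[a, c] (EFin \o f) ->
  \int[mu]_(t in `[a, c]) f t = \int[mu]_(t in `[a, b]) f t + \int[mu]_(t in `[b, c]) f t.
Proof.
move=> ab bc fi.
have := @Rintegral_itvB _ f (BLeft a) (BRight c) b fi; rewrite !bnd_simp => /(_ ab bc) E.
apply/eqP; rewrite addrC -subr_eq E Rintegral_itv_obnd_cbnd//.
apply: integrableS fi => //; apply: subset_itvr; rewrite bnd_simp.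
exact: ab.
Qed.

Lemma cint_split a b c h : a <= b -> b <= c -> cintegrable `[a, c] h ->
  cint `[a, c] h = cint `[a, b] h + cint `[b, c] h.
Proof.
move=> ab bc [h1 h2]; apply/eqP; rewrite eq_complex /=.
by rewrite !(Rintegral_itv_split ab bc) ?eqxx.
Qed.

(** Continuity relative to the segment: at the end points only values from inside are compared,
    which suits functions known only on a rectangle. *)
Definition rcont_on a b (u : R -> R) := forall t, a <= t <= b -> forall e, 0 < e ->
  exists2 d, 0 < d & forall t', a <= t' <= b -> `|t' - t| < d -> `|u t' - u t| < e.

Lemma rcont_on_integrable a b u : rcont_on a b u -> mu.-integrable `[a, b] (EFin \o u).
Proof.
move=> cu; apply: continuous_compact_integrable; first exact: segment_compact.
apply/subspace_continuousP => t; rewrite /= in_itv/= => tab.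
apply/cvgrPdist_lt => e e0; have [d d0 ud] := cu t tab e e0.
rewrite /prop_near1 /nbhs /= /within /=.
apply/nbhs_ballP; exists d => // t' /= t't; rewrite in_itv /= distrC => t'ab.
by apply: ud => //; rewrite distrC.
Qed.

Definition ccont_on a b h := forall t, a <= t <= b -> forall e, 0 < e ->
  exists2 d, 0 < d & forall t', a <= t' <= b -> `|t' - t| < d -> cabs (h t' - h t) < e.

Lemma ccont_on_cintegrable a b h : ccont_on a b h -> cintegrable `[a, b] h.
Proof.
move=> ch; split; apply: rcont_on_integrable => t tab e e0.
  have [d d0 hd] := ch t tab e e0; exists d => // t' t'ab t't.
  by rewrite -ReB; apply: le_lt_trans (hd t' t'ab t't); exact: ler_Re_cabs.
have [d d0 hd] := ch t tab e e0; exists d => // t' t'ab t't.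
by rewrite -ImB; apply: le_lt_trans (hd t' t'ab t't); exact: ler_Im_cabs.
Qed.

Lemma ccont_on_cabs a b h : ccont_on a b h -> rcont_on a b (fun t => cabs (h t)).
Proof.
move=> ch t tab e e0; have [d d0 hd] := ch t tab e e0; exists d => // t' t'ab t't.
apply: le_lt_trans (hd t' t'ab t't); rewrite ler_norml.
have := lerB_cabsB (h t') (h t); have := lerB_cabsB (h t) (h t').
by rewrite (cabsC (h t)); lra.
Qed.

Lemma cabs_horizontal (x x' y : R) : cabs (Complex x y - Complex x' y) = `|x - x'|.
Proof. by rewrite /cabs /= subrr expr0n addr0 sqrtr_sqr. Qed.

Lemma cabs_vertical (x y y' : R) : cabs (Complex x y - Complex x y') = `|y - y'|.
Proof. by rewrite /cabs /= subrr expr0n add0r sqrtr_sqr. Qed.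

Lemma cdiff_ccont_horizontal (F : R[i] -> R[i]) a b y :
  (forall t, a <= t <= b -> cdiff F (Complex t y)) ->
  ccont_on a b (fun t => F (Complex t y)).
Proof.
move=> dF t tab e e0; have [d d0 Fd] := cdiff_continuous (dF t tab) e0.
by exists d => // t' _ t't; apply: Fd; rewrite cabs_horizontal.
Qed.

Lemma cdiff_ccont_vertical (F : R[i] -> R[i]) a b x :
  (forall t, a <= t <= b -> cdiff F (Complex x t)) ->
  ccont_on a b (fun t => F (Complex x t)).
Proof.
move=> dF t tab e e0; have [d d0 Fd] := cdiff_continuous (dF t tab) e0.
by exists d => // t' _ t't; apply: Fd; rewrite cabs_vertical.
Qed.

End ComplexIntegral.

Opaque cint cintegrable.

(** * Goursat's theorem for rectangles *)

Section Rectangles.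
Context {R : realType}.
Implicit Types (F : R[i] -> R[i]) (a b c d : R).

(* The contour integral over the boundary, with opposite sides paired. *)
Definition rect_int F a b c d : R[i] :=
  cint `[a, b] (fun x => F (Complex x c) - F (Complex x d)) +
  Complex 0 1 * cint `[c, d] (fun y => F (Complex b y) - F (Complex a y)).

Lemma rect_int_split_horizontal F a m b c d : a <= m -> m <= b ->
  cintegrable `[a, b] (fun x => F (Complex x c)) ->
  cintegrable `[a, b] (fun x => F (Complex x d)) ->
  cintegrable `[c, d] (fun y => F (Complex a y)) ->
  cintegrable `[c, d] (fun y => F (Complex m y)) ->
  cintegrable `[c, d] (fun y => F (Complex b y)) ->
  rect_int F a b c d = rect_int F a m c d + rect_int F m b c d.
Proof.
move=> am mb ic id ia im ib.
rewrite /rect_int (cint_split am mb); last exact: cintegrableB.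
rewrite !(cintB (D := `[c, d]))//; ring.
Qed.

Lemma rect_int_split_vertical F a b c m d : c <= m -> m <= d ->
  cintegrable `[a, b] (fun x => F (Complex x c)) ->
  cintegrable `[a, b] (fun x => F (Complex x m)) ->
  cintegrable `[a, b] (fun x => F (Complex x d)) ->
  cintegrable `[c, d] (fun y => F (Complex a y)) ->
  cintegrable `[c, d] (fun y => F (Complex b y)) ->
  rect_int F a b c d = rect_int F a b c m + rect_int F a b m d.
Proof.
move=> cm md ic im id ia ib.
rewrite /rect_int (cint_split cm md); last exact: cintegrableB.
rewrite !(cintB (D := `[a, b]))//; ring.
Qed.

Lemma ler_rect_int F a b c d B : a <= b -> c <= d ->
  cintegrable `[a, b] (fun x => F (Complex x c)) ->
  cintegrable `[a, b] (fun x => F (Complex x d)) ->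
  cintegrable `[c, d] (fun y => F (Complex a y)) ->
  cintegrable `[c, d] (fun y => F (Complex b y)) ->
  (forall x, a <= x <= b -> cabs (F (Complex x c)) <= B /\ cabs (F (Complex x d)) <= B) ->
  (forall y, c <= y <= d -> cabs (F (Complex a y)) <= B /\ cabs (F (Complex b y)) <= B) ->
  cabs (rect_int F a b c d) <= 2 * B * ((b - a) + (d - c)).
Proof.
move=> ab cd ic id ia ib Bh Bv; rewrite mulrDr.
apply: (le_trans (ler_cabsD _ _)); rewrite cabsM cabs_i mul1r lerD//.
  apply: ler_cabs_cint_itv => //; first exact: cintegrableB.
  by move=> x /Bh[h1 h2]; apply: (le_trans (ler_cabsB _ _)); lra.
apply: ler_cabs_cint_itv => //; first exact: cintegrableB.
by move=> y /Bv[h1 h2]; apply: (le_trans (ler_cabsB _ _)); lra.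
Qed.

Definition cdiff_rect F a b c d := forall x y, a <= x <= b -> c <= y <= d ->
  cdiff F (Complex x y).

Lemma cdiff_rect_horizontal F a b c d y : cdiff_rect F a b c d -> c <= y <= d ->
  cintegrable `[a, b] (fun x => F (Complex x y)).
Proof.
by move=> dF cyd; apply/ccont_on_cintegrable/cdiff_ccont_horizontal => x xab; exact: dF.
Qed.

Lemma cdiff_rect_vertical F a b c d x : cdiff_rect F a b c d -> a <= x <= b ->
  cintegrable `[c, d] (fun y => F (Complex x y)).
Proof.
by move=> dF axb; apply/ccont_on_cintegrable/cdiff_ccont_vertical => y ycd; exact: dF.
Qed.

Lemma cdiff_rectS F a b c d a' b' c' d' : a <= a' -> b' <= b -> c <= c' -> d' <= d ->
  cdiff_rect F a b c d -> cdiff_rect F a' b' c' d'.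
Proof. by move=> aa bb cc dd dF x y *; apply: dF; lra. Qed.

Lemma cdiff_rect_int_split_horizontal F a m b c d : a <= m -> m <= b -> c <= d ->
  cdiff_rect F a b c d -> rect_int F a b c d = rect_int F a m c d + rect_int F m b c d.
Proof.
move=> am mb cd dF; apply: rect_int_split_horizontal => //.
- by apply: (cdiff_rect_horizontal dF); lra.
- by apply: (cdiff_rect_horizontal dF); lra.
- by apply: (cdiff_rect_vertical dF); lra.
- by apply: (cdiff_rect_vertical dF); lra.
- by apply: (cdiff_rect_vertical dF); lra.
Qed.

Lemma cdiff_rect_int_split_vertical F a b c m d : c <= m -> m <= d -> a <= b ->
  cdiff_rect F a b c d -> rect_int F a b c d = rect_int F a b c m + rect_int F a b m d.
Proof.
move=> cm md ab dF; apply: rect_int_split_vertical => //.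
- by apply: (cdiff_rect_horizontal dF); lra.
- by apply: (cdiff_rect_horizontal dF); lra.
- by apply: (cdiff_rect_horizontal dF); lra.
- by apply: (cdiff_rect_vertical dF); lra.
- by apply: (cdiff_rect_vertical dF); lra.
Qed.

(** The horizontal and vertical sides contribute opposite multiples of [v (b - a) (d - c)]. This
    lets the first-order Taylor polynomial be subtracted before estimating. *)
Lemma rect_int_affine F a b c d (u v : R[i]) : a <= b -> c <= d ->
  cdiff_rect F a b c d ->
  rect_int (fun z => F z - (u + v * z)) a b c d = rect_int F a b c d.
Proof.
move=> ab cd dF; rewrite /rect_int.
have cc : c <= c <= d by rewrite lexx.
have dd : c <= d <= d by rewrite lexx cd.
have aa : a <= a <= b by rewrite lexx.
have bb : a <= b <= b by rewrite lexx ab.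
have ih := cdiff_rect_horizontal dF.
have iv := cdiff_rect_vertical dF.
have E1 : cint `[a, b] (fun x => F (Complex x c) - (u + v * Complex x c) -
    (F (Complex x d) - (u + v * Complex x d))) =
    cint `[a, b] (fun x => F (Complex x c) - F (Complex x d)) -
    v * Complex 0 (c - d) * (b - a)%:C%C.
  rewrite -cint_cst// -cintB//.
  - apply: eq_cint => x _; rewrite (_ : Complex 0 (c - d) = Complex x c - Complex x d).
      ring.
    by apply/eqP; rewrite eq_complex /= subrr !eqxx.
  - by apply: cintegrableB => //; [exact: ih|exact: ih].
  - exact: cintegrable_cst.
have E2 : cint `[c, d] (fun y => F (Complex b y) - (u + v * Complex b y) -
    (F (Complex a y) - (u + v * Complex a y))) =
    cint `[c, d] (fun y => F (Complex b y) - F (Complex a y)) -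
    v * (b - a)%:C%C * (d - c)%:C%C.
  rewrite -cint_cst// -cintB//.
  - apply: eq_cint => y _; rewrite (_ : (b - a)%:C%C = Complex b y - Complex a y).
      ring.
    by apply/eqP; rewrite eq_complex /= subrr !eqxx.
  - by apply: cintegrableB => //; [exact: iv|exact: iv].
  - exact: cintegrable_cst.
rewrite E1 E2.
have -> : Complex 0 (c - d) = - (Complex 0 1 * (d - c)%:C%C).
  by apply/eqP; rewrite eq_complex /=; apply/andP; split; apply/eqP; ring.
ring.
Qed.

(** With [l] the half-perimeter, the integrand minus its affine part is at most [e l], and the
    contour has length [2 l]. *)
Lemma ler_rect_int_cdiff F a b c d p (D : R[i]) e : a <= b -> c <= d -> 0 <= e ->
  cdiff_rect F a b c d -> a <= complex.Re p <= b -> c <= complex.Im p <= d ->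
  (forall x y, a <= x <= b -> c <= y <= d -> cabs (F (Complex x y) - F p -
    D * (Complex x y - p)) <= e * cabs (Complex x y - p)) ->
  cabs (rect_int F a b c d) <= 2 * e * ((b - a) + (d - c)) ^+ 2.
Proof.
move=> ab cd e0 dF pab pcd Fp.
rewrite -(rect_int_affine (F p - D * p) D ab cd dF).
set G := (fun z => _).
have dG : cdiff_rect G a b c d.
  move=> x y xab ycd; apply: cdiffB; first exact: dF.
  by apply: cdiffD; [exact: cdiff_cst|apply: cdiffM; [exact: cdiff_cst|exact: cdiff_id]].
have Gl x y : a <= x <= b -> c <= y <= d -> cabs (G (Complex x y)) <= e * ((b - a) + (d - c)).
  move=> xab ycd; rewrite /G (_ : _ - _ = F (Complex x y) - F p - D * (Complex x y - p)).
    apply: (le_trans (Fp x y xab ycd)); rewrite ler_wpM2l//.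
    apply: (le_trans (ler_cabs_ReIm _)); rewrite ReB ImB /=; apply: lerD;
    by rewrite ler_norml; apply/andP; split; lra.
  ring.
rewrite expr2 !mulrA -(mulrA 2); apply: ler_rect_int => //.
- by apply: (cdiff_rect_horizontal dG); rewrite lexx.
- by apply: (cdiff_rect_horizontal dG); rewrite lexx andbT.
- by apply: (cdiff_rect_vertical dG); rewrite lexx.
- by apply: (cdiff_rect_vertical dG); rewrite lexx andbT.
- by move=> x xab; split; apply: Gl => //; rewrite lexx ?andbT.
- by move=> y ycd; split; apply: Gl => //; rewrite lexx ?andbT.
Qed.

Let rect_int4 F (q : R * R * R * R) :=
  rect_int F q.1.1.1 q.1.1.2 q.1.2 q.2.

Let quarter (i j : bool) (q : R * R * R * R) : R * R * R * R :=
  let: (a, b, c, d) := q in let m := (a + b) / 2 in let n := (c + d) / 2 in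
  (if i then m else a, if i then b else m, if j then n else c, if j then d else n).

Let heavy F q := [pick ij : bool * bool |
  cabs (rect_int4 F q) <= 4 * cabs (rect_int4 F (quarter ij.1 ij.2 q))].

(** The default branch is never taken on a [good] rectangle, by [bisectP]. *)
Let bisect F q := if heavy F q is Some ij then quarter ij.1 ij.2 q else q.

Let good F (q : R * R * R * R) := q.1.1.1 <= q.1.1.2 /\ q.1.2 <= q.2 /\
  cdiff_rect F q.1.1.1 q.1.1.2 q.1.2 q.2.

Let bisectP F q : good F q -> exists i j, bisect F q = quarter i j q /\
  cabs (rect_int4 F q) <= 4 * cabs (rect_int4 F (quarter i j q)).
Proof.
move=> qF; rewrite /bisect /heavy; case: pickP => [[i j] /= h|h]; first by exists i, j.
(* If each quarter carried less than a fourth of the modulus, the triangle inequality would fail for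
   their sum, which is the whole integral. *)
exfalso; move: q qF h => [[[a b] c] d] [/= ab [cd dF]] h.
have mab : a <= (a + b) / 2 <= b by lra.
have ncd : c <= (c + d) / 2 <= d by lra.
set m := (a + b) / 2 in mab h; set n := (c + d) / 2 in ncd h.
have [am mb] := andP mab; have [cn nd] := andP ncd.
have dl : cdiff_rect F a m c d by apply: cdiff_rectS dF.
have dr : cdiff_rect F m b c d by apply: cdiff_rectS dF.
have E : rect_int F a b c d = rect_int F a m c n + rect_int F a m n d +
    (rect_int F m b c n + rect_int F m b n d).
  rewrite (cdiff_rect_int_split_horizontal am mb cd dF).
  rewrite (cdiff_rect_int_split_vertical cn nd am dl).
  by rewrite (cdiff_rect_int_split_vertical cn nd mb dr).
have := h (false, false); have := h (true, false).
have := h (false, true); have := h (true, true).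
rewrite /rect_int4 /=.
move=> /negbT; rewrite -ltNge => h1 /negbT; rewrite -ltNge => h2.
move=> /negbT; rewrite -ltNge => h3 /negbT; rewrite -ltNge => h4.
have := ler_cabsD (rect_int F a m c n) (rect_int F a m n d).
have := ler_cabsD (rect_int F m b c n) (rect_int F m b n d).
have := ler_cabsD (rect_int F a m c n + rect_int F a m n d)
  (rect_int F m b c n + rect_int F m b n d).
rewrite -E; clear -h1 h2 h3 h4; lra.
Qed.

Lemma nested_intervals (u v : nat -> R) :
  (forall n, u n <= u n.+1) -> (forall n, v n.+1 <= v n) -> (forall n, u n <= v n) ->
  exists p, forall n, u n <= p <= v n.
Proof.
move=> hu hv uv.
have uM : {homo u : n m / (n <= m)%N >-> n <= m} by apply: homo_leq => //; exact: le_trans.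
have vM : {homo v : n m / (n <= m)%N >-> m <= n}.
  by apply: homo_leq => // x y z xy yz; exact: le_trans yz xy.
have uvmn m n : u m <= v n.
  apply: le_trans (uM _ _ (leq_maxl m n)) _.
  by apply: le_trans (uv _) _; exact: vM (leq_maxr m n).
exists (sup (range u)) => n; apply/andP; split.
  apply: ub_le_sup; last by exists n.
  by exists (v 0%N) => _ [m _ <-].
by apply: ge_sup; [exists (u 0%N), 0%N|move=> _ [m _ <-]].
Qed.

Lemma goursat F a b c d : a <= b -> c <= d -> cdiff_rect F a b c d ->
  rect_int F a b c d = 0.
Proof.
move=> ab cd dF; pose q n := iter n (bisect F) (a, b, c, d).
pose l := (b - a) + (d - c).
have l0 : 0 <= l by rewrite /l; lra.
have good_q n : good F (q n).
  elim: n => [|n IH]; first by split.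
  have [i [j [E _]]] := bisectP IH; rewrite /q iterS -/(q n) E {E}.
  case: (q n) IH => [[[a' b'] c'] d'] [/= ab' [cd' dF']].
  by split; [case: i; rewrite /=; lra|split; [case: j; rewrite /=; lra|]];
    case: i; case: j => /=; apply: cdiff_rectS dF' => //; lra.
have step n : exists i j, q n.+1 = quarter i j (q n).
  by have [i [j [E _]]] := bisectP (good_q n); exists i, j; rewrite /q iterS.
have [px hpx] : exists p, forall n, (q n).1.1.1 <= p <= (q n).1.1.2.
  apply: nested_intervals => n; have [h1 [h2 _]] := good_q n;
    have [i [j E]] := step n; rewrite ?E {E}//;
    by case: (q n) h1 h2 => [[[a' b'] c'] d'] /= h1 h2; case: i => /=; lra.
have [py hpy] : exists p, forall n, (q n).1.2 <= p <= (q n).2.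
  apply: nested_intervals => n; have [h1 [h2 _]] := good_q n;
    have [i [j E]] := step n; rewrite ?E {E}//;
    by case: (q n) h1 h2 => [[[a' b'] c'] d'] /= h1 h2; case: j => /=; lra.
have lq n : ((q n).1.1.2 - (q n).1.1.1) + ((q n).2 - (q n).1.2) = l / 2 ^+ n.
  elim: n => [|n IH]; first by rewrite expr0 divr1.
  rewrite exprS invfM mulrCA mulrC -IH; have [i [j ->]] := step n.
  by case: (q n) => [[[a' b'] c'] d'] /=; case: i; case: j => /=; lra.
have iq n : cabs (rect_int F a b c d) <= 4 ^+ n * cabs (rect_int4 F (q n)).
  elim: n => [|n IH]; first by rewrite expr0 mul1r.
  apply: le_trans IH _; rewrite exprSr -mulrA ler_wpM2l ?exprn_ge0//.
  by have [i [j [E h]]] := bisectP (good_q n); rewrite /q iterS -/(q n) E.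
have pF : cdiff F (Complex px py) by apply: dF; [exact: (hpx 0%N)|exact: (hpy 0%N)].
apply/eqP; rewrite -cabs_eq0; apply/eqP/le_anti; rewrite cabs_ge0 andbT.
apply/ler_addgt0Pl => e e0; rewrite addr0.
have [D FD] := (cdiffP F (Complex px py)).1 pF.
(* After [n] bisections an error rate [e'] yields [4 ^ n * 2 e' (l / 2 ^ n) ^ 2 = 2 e' l ^ 2], which
   this choice keeps below [e]; the [+ 1] covers [l = 0]. *)
have e'0 : 0 < e / (2 * l ^+ 2 + 1) by rewrite divr_gt0// ltr_wpDl// mulr_ge0// exprn_ge0.
have [r r0 Fr] := FD _ e'0.
have [n ln] : exists n, l / 2 ^+ n < r.
  exists (Num.bound (l / r)); rewrite ltr_pdivrMr ?exprn_gt0// -ltr_pdivrMl// mulrC.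
  apply: (lt_le_trans (archi_boundP _)); first by rewrite divr_ge0// ltW.
  by rewrite -natrX ler_nat ltnW// ltn_expl.
apply: (le_trans (iq n)).
have [/= abn [cdn dFn]] := good_q n.
have : cabs (rect_int4 F (q n)) <= 2 * (e / (2 * l ^+ 2 + 1)) * (l / 2 ^+ n) ^+ 2.
  rewrite -lq; apply: (ler_rect_int_cdiff (p := Complex px py) (D := D) abn cdn (ltW e'0) dFn
    (hpx n) (hpy n)).
  move=> x y hx hy; apply: Fr; apply: le_lt_trans ln; rewrite -lq.
  apply: (le_trans (ler_cabs_ReIm _)); rewrite ReB ImB /=.
  by have h1 := hpx n; have h2 := hpy n; apply: lerD; rewrite ler_norml; lra.
move=> h; apply: (le_trans (ler_wpM2l _ h)); first by rewrite exprn_ge0.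
have -> : 4 ^+ n * (2 * (e / (2 * l ^+ 2 + 1)) * (l / 2 ^+ n) ^+ 2) =
    e * ((2 * l ^+ 2) / (2 * l ^+ 2 + 1)).
  have -> : (4 : R) = 2 ^+ 2 by rewrite -natrX.
  rewrite -exprM mulnC exprM; field.
  by rewrite !gt_eqF// ?exprn_gt0// ltr_wpDl// mulr_ge0// sqr_ge0.
rewrite ler_piMr ?(ltW e0)// ler_pdivrMr ?mul1r ?lerDl//.
by rewrite ltr_wpDl// mulr_ge0// sqr_ge0.
Qed.

End Rectangles.

(** * Punctured rectangles and the Poisson inequality on a vertical line *)

Section PoissonInequality.
Context {R : realType}.
Notation mu := (@lebesgue_measure R).
Implicit Types (F k : R[i] -> R[i]) (a b c d L : R) (w z : R[i]).

Lemma exists_small (s : seq R) : all (fun x => 0 < x) s ->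
  exists2 e, 0 < e & all (fun x => e <= x) s.
Proof.
elim: s => [|x s IH] /=; first by exists 1.
move=> /andP[x0 /IH[e e0 es]]; exists (Num.min e x); first by rewrite lt_min e0.
rewrite ge_min lexx orbT /=; apply: sub_all es => y ey.
by rewrite ge_min ey.
Qed.

Let Complex_neq (x y p q : R) : x != p \/ y != q -> Complex x y != Complex p q.
Proof. by rewrite eq_complex /= negb_and => -[->//|->]; rewrite orbT. Qed.

Local Ltac ord H := clear -H; lra.
Local Ltac edge f g H := apply: f; [exact: g|ord H|ord H|ord H].

(** The four rectangles cut off on the left, right, bottom and top avoid the singular point
    [(p, q)], so Goursat's theorem makes their integrals vanish. *)
Let rect_int_shrink F a p1 p p2 b c q1 q q2 d :
  a < p1 -> p1 < p -> p < p2 -> p2 < b -> c < q1 -> q1 < q -> q < q2 -> q2 < d ->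
  (forall x y, a <= x <= b -> c <= y <= d -> x != p \/ y != q -> cdiff F (Complex x y)) ->
  rect_int F a b c d = rect_int F p1 p2 q1 q2.
Proof.
move=> h1 h2 h3 h4 h5 h6 h7 h8 hF.
have ih y x1 x2 : y != q -> c <= y <= d -> a <= x1 -> x2 <= b ->
    cintegrable `[x1, x2] (fun x => F (Complex x y)).
  move=> yq cyd ax1 x2b; apply/ccont_on_cintegrable/cdiff_ccont_horizontal => x xx.
  by apply: hF => //; [clear -xx ax1 x2b; lra|right].
have iv x y1 y2 : x != p -> a <= x <= b -> c <= y1 -> y2 <= d ->
    cintegrable `[y1, y2] (fun y => F (Complex x y)).
  move=> xp axb cy1 y2d; apply/ccont_on_cintegrable/cdiff_ccont_vertical => y yy.
  by apply: hF => //; [clear -yy cy1 y2d; lra|left].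
have zero a' b' c' d' : a <= a' -> a' <= b' -> b' <= b -> c <= c' -> c' <= d' -> d' <= d ->
    [|| b' < p, p < a', d' < q | q < c'] -> rect_int F a' b' c' d' = 0.
  move=> aa ab bb cc cd dd h; apply: goursat => // x y hx hy.
  apply: hF; [clear -hx aa bb; lra|clear -hy cc dd; lra|].
  apply/orP; rewrite -negb_and; apply/negP => /andP[/eqP E1 /eqP E2].
  by move: hx hy h; rewrite E1 E2; clear; lra.
have [cq dq ap bp] : [/\ c != q, d != q, a != p & b != p].
  by split; apply/eqP; clear -h1 h2 h3 h4 h5 h6 h7 h8; lra.
have [p1p p2p q1q q2q] : [/\ p1 != p, p2 != p, q1 != q & q2 != q].
  by split; apply/eqP; clear -h2 h3 h6 h7; lra.
have H : [&& a < p1, p1 < p, p < p2, p2 < b, c < q1, q1 < q, q < q2 & q2 < d].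
  by rewrite h1 h2 h3 h4 h5 h6 h7.
rewrite (rect_int_split_horizontal (m := p1));
  [|ord H|ord H|edge ih cq H|edge ih dq H|edge iv ap H|edge iv p1p H|edge iv bp H].
rewrite [X in X + _](zero); [|ord H|ord H|ord H|ord H|ord H|ord H|ord H].
rewrite add0r (rect_int_split_horizontal (m := p2));
  [|ord H|ord H|edge ih cq H|edge ih dq H|edge iv p1p H|edge iv p2p H|edge iv bp H].
rewrite [X in _ + X](zero); [|ord H|ord H|ord H|ord H|ord H|ord H|ord H].
rewrite addr0 (rect_int_split_vertical (m := q1));
  [|ord H|ord H|edge ih cq H|edge ih q1q H|edge ih dq H|edge iv p1p H|edge iv p2p H].
rewrite [X in X + _](zero); [|ord H|ord H|ord H|ord H|ord H|ord H|ord H].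
rewrite add0r (rect_int_split_vertical (m := q2));
  [|ord H|ord H|edge ih q1q H|edge ih q2q H|edge ih dq H|edge iv p1p H|edge iv p2p H].
rewrite [X in _ + X](zero); [|ord H|ord H|ord H|ord H|ord H|ord H|ord H].
by rewrite addr0.
Qed.

(** The contour shrinks to a square of side [2 e] around [w], whose integral is at most [8 B e].
    Mere boundedness near [w] thus suffices, without removing the singularity. *)
Lemma goursat_punctured F a b c d w B :
  a < complex.Re w < b -> c < complex.Im w < d ->
  (forall z, a <= complex.Re z <= b -> c <= complex.Im z <= d -> z != w ->
    cdiff F z /\ cabs (F z) <= B) ->
  rect_int F a b c d = 0.
Proof.
case: w => p q /= /andP[ap pb] /andP[cq qd] hF.
have hD x y : a <= x <= b -> c <= y <= d -> x != p \/ y != q -> cdiff F (Complex x y).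
  by move=> hx hy xy; have [] := hF (Complex x y) hx hy (Complex_neq xy).
have hB x y : a <= x <= b -> c <= y <= d -> x != p \/ y != q -> cabs (F (Complex x y)) <= B.
  by move=> hx hy xy; have [] := hF (Complex x y) hx hy (Complex_neq xy).
have B0 : 0 <= B.
  have := hB a c; rewrite !lexx (ltW (lt_trans ap pb)) (ltW (lt_trans cq qd)).
  move=> /(_ isT isT (or_introl (negbT (lt_eqF ap)))).
  exact/le_trans/cabs_ge0.
clear hF; apply/eqP; rewrite -cabs_eq0; apply/eqP/le_anti; rewrite cabs_ge0 andbT.
apply/ler_addgt0Pl => t t0; rewrite addr0.
have B1 : 0 < 8 * B + 1 by clear -B0; lra.
have [|e e0 /=] := @exists_small [:: (p - a) / 2; (b - p) / 2; (q - c) / 2; (d - q) / 2;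
    t / (8 * B + 1)].
  by rewrite /= !divr_gt0 ?subr_gt0.
move=> /and5P[e1 e2 e3 e4]; rewrite andbT ler_pdivlMr// => e5.
have [i1 i2 i3 i4] : [/\ a < p - e, p + e < b, c < q - e & q + e < d].
  by clear -e1 e2 e3 e4 e0 ap pb cq qd; split; lra.
have [i5 i6 i7 i8] : [/\ p - e < p, p < p + e, q - e < q & q < q + e].
  by clear -e0; split; lra.
rewrite (rect_int_shrink i1 i5 i6 i2 i3 i7 i8 i4 hD).
apply: (@le_trans _ _ (2 * B * (((p + e) - (p - e)) + ((q + e) - (q - e))))); last first.
  by clear -e5 e0; lra.
have [pe1 pe2 qe1 qe2] : [/\ p - e != p, p + e != p, q - e != q & q + e != q].
  by rewrite (lt_eqF i5) (gt_eqF i6) (lt_eqF i7) (gt_eqF i8).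
have hx x : p - e <= x <= p + e -> a <= x <= b by clear -i1 i2; lra.
have hy y : q - e <= y <= q + e -> c <= y <= d by clear -i3 i4; lra.
have cx y : y != q -> c <= y <= d -> cintegrable `[p - e, p + e] (fun x => F (Complex x y)).
  move=> yq cyd; apply/ccont_on_cintegrable/cdiff_ccont_horizontal => x /hx xx.
  by apply: hD => //; right.
have cy x : x != p -> a <= x <= b -> cintegrable `[q - e, q + e] (fun y => F (Complex x y)).
  move=> xp axb; apply/ccont_on_cintegrable/cdiff_ccont_vertical => y /hy yy.
  by apply: hD => //; left.
have [x1 x2] : a <= p - e <= b /\ a <= p + e <= b by clear -i1 i2 e0; split; lra.
have [y1 y2] : c <= q - e <= d /\ c <= q + e <= d by clear -i3 i4 e0; split; lra.
apply: ler_rect_int; [clear -e0; lra|clear -e0; lra|exact: cx|exact: cx|exact: cy|exact: cy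
  |move=> x /hx xx|move=> y /hy yy].
- by split; apply: hB => //; right.
- by split; apply: hB => //; left.
Qed.

(** The Poisson kernel of a half-plane for a point at distance [a] from its boundary line, without
    the factor [a / pi]. *)
Definition poisson a b (y : R) : R := (a ^+ 2 + (y - b) ^+ 2)^-1.

Lemma poisson_denom_gt0 a b (y : R) : 0 < a -> 0 < a ^+ 2 + (y - b) ^+ 2.
Proof. by move=> a0; rewrite ltr_pwDl ?exprn_gt0// sqr_ge0. Qed.

Lemma poisson_ge0 a b (y : R) : 0 <= poisson a b y.
Proof. by rewrite invr_ge0 addr_ge0// sqr_ge0. Qed.

Lemma poisson_le a b (y : R) : 0 < a -> poisson a b y <= (a ^+ 2)^-1.
Proof.
by move=> a0; rewrite lef_pV2 ?posrE ?exprn_gt0 ?poisson_denom_gt0// lerDl sqr_ge0.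
Qed.

(** On the line, the difference to the mirror image is minus the conjugate of the difference to the
    point itself. So the product of the two Cauchy kernels is, up to sign, the Poisson kernel. *)
Lemma poisson_line (x0 a b y : R) : 0 < a ->
  (Complex x0 y - Complex (x0 + a) b) * (Complex x0 y - Complex (x0 - a) b) =
  - (poisson a b y)^-1%:C%C.
Proof.
move=> a0; rewrite /poisson invrK; apply/eqP; rewrite eq_complex /=.
by apply/andP; split; apply/eqP; ring.
Qed.

Lemma poisson_mul_ccont_on k s x0 a b (c d : R) : s < x0 -> 0 < a ->
  (forall z, s < complex.Re z -> cdiff k z) ->
  ccont_on c d (fun y => (poisson a b y)%:C%C * k (Complex x0 y)).
Proof.
move=> sx0 a0 dk.
pose G z := - (k z / ((z - Complex (x0 + a) b) * (z - Complex (x0 - a) b))).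
rewrite (_ : (fun y => _) = fun y => G (Complex x0 y)).
  apply: cdiff_ccont_vertical => y _; rewrite /G.
  under [fun z => - _]eq_fun do rewrite -mulN1r.
  apply: cdiffM; first exact: cdiff_cst.
  apply: cdiff_div; last 2 first.
  - exact: dk.
  - by apply: cdiffM; exact: cdiff_subr.
  rewrite poisson_line// oppr_eq0 eq_complex /= eqxx andbT invrK.
  by rewrite gt_eqF// poisson_denom_gt0.
apply/funext => y; rewrite /G poisson_line// invrN mulrN opprK mulrC.
by congr (_ * _); rewrite fmorphV/= invrK.
Qed.

Lemma poisson_integrable a b c d : 0 < a -> mu.-integrable `[c, d] (EFin \o poisson a b).
Proof.
move=> a0; have := @poisson_mul_ccont_on (fun=> 1) 0 1 a b c d ltr01 a0.
move=> /(_ (fun z _ => @cdiff_cst R 1 z))/ccont_on_cabs/rcont_on_integrable.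
apply: eq_integrable => // y _ /=.
by rewrite mulr1 cabs_real ger0_norm// poisson_ge0.
Qed.

(** On [[b - a, b + a]], of length [2 a], the kernel is at least [1 / (2 a ^ 2)]. *)
Lemma poisson_mass a b L : 0 < a -> a <= L ->
  a^-1 <= \int[mu]_(y in `[b - L, b + L]) poisson a b y.
Proof.
move=> a0 aL.
have i1 := poisson_integrable b (b - L) (b + L) a0.
have i2 := poisson_integrable b (b - a) (b + L) a0.
rewrite (Rintegral_itv_split (b := b - a)); [|lra|lra|exact: i1].
rewrite (Rintegral_itv_split (a := b - a) (b := b + a)); [|lra|lra|exact: i2].
have n (c d : R) : 0 <= \int[mu]_(y in `[c, d]) poisson a b y.
  by apply: Rintegral_ge0 => y _; exact: poisson_ge0.
have h : a^-1 <= \int[mu]_(y in `[b - a, b + a]) poisson a b y.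
  rewrite (_ : a^-1 = (2 * a ^+ 2)^-1 * ((b + a) - (b - a))); last first.
    by field; rewrite gt_eqF.
  rewrite -Rintegral_cst_itv; last lra.
  apply: le_Rintegral => //; [exact: integrable_cst_itv|exact: poisson_integrable|].
  move=> y; rewrite /= in_itv/= => hy.
  rewrite lef_pV2 ?posrE ?poisson_denom_gt0 ?mulr_gt0 ?exprn_gt0//.
  have : 0 <= (a - (y - b)) * (a + (y - b)) by rewrite mulr_ge0//; lra.
  by lra.
by apply: (le_trans h); rewrite ler_wpDl// ler_wpDr.
Qed.

(** The left side of the rectangle gives the two Poisson integrals; the other sides form the error.
    The horizontal ones contribute [4 C / L], the far one [8 C / L], since [2 a <= L] keeps it at
    distance at least [L / 2] from [w]. *)
Lemma poisson_ineq k s C x0 a b L : s < x0 -> 0 < a -> 2 * a <= L ->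
  (forall z, s < complex.Re z -> cdiff k z) ->
  (forall z, s < complex.Re z -> cabs (k z) <= C) ->
  cabs (k (Complex (x0 + a) b)) * \int[mu]_(y in `[b - L, b + L]) poisson a b y <=
  \int[mu]_(y in `[b - L, b + L]) (poisson a b y * cabs (k (Complex x0 y))) + 12 * C / L.
Proof.
move=> sx0 a0 aL dk kC; set w := Complex (x0 + a) b; pose w' := Complex (x0 - a) b.
have L0 : 0 < L by clear -a0 aL; lra.
have kw : cabs (k w) <= C by apply: kC; rewrite /w /=; clear -sx0 a0; lra.
have C0 : 0 <= C by apply: le_trans kw; exact: cabs_ge0.
pose F z := (k z - k w) / ((z - w) * (z - w')).
have zw'a z : x0 <= complex.Re z -> a <= cabs (z - w').
  move=> h; apply: le_trans (ler_Re_cabs _); apply: le_trans (ler_norm _).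
  by rewrite ReB /w' /=; clear -h; lra.
have zw' z : x0 <= complex.Re z -> z - w' != 0.
  by move=> /zw'a h; rewrite -cabs_gt0; exact: lt_le_trans h.
have dF z : x0 <= complex.Re z -> z != w -> cdiff F z.
  move=> h zw; apply: cdiff_div.
  - by rewrite mulf_neq0 ?zw'// subr_eq0.
  - by apply: cdiffB; [apply: dk; exact: lt_le_trans h|exact: cdiff_cst].
  - by apply: cdiffM; exact: cdiff_subr.
have FB z u v : s < complex.Re z -> 0 < u -> 0 < v -> u <= cabs (z - w) ->
    v <= cabs (z - w') -> cabs (F z) <= 2 * C / (u * v).
  move=> sz u0 v0 hu hv; rewrite /F cabsM cabsV cabsM ler_pM ?invr_ge0 ?mulr_ge0 ?cabs_ge0//.
    by apply: (le_trans (ler_cabsB _ _)); have := kC z sz; clear -kw; lra.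
  rewrite lef_pV2 ?posrE ?mulr_gt0 ?(lt_le_trans u0 hu) ?(lt_le_trans v0 hv)//.
  by rewrite ler_pM// ltW.
(* Near [w] the quotient is bounded because [k] is Lipschitz at [w]; farther away [FB] applies. *)
have F0 : rect_int F x0 (x0 + L) (b - L) (b + L) = 0.
  have [|B [d d0 hB]] := @cdiff_lipschitz _ k w.
    by apply: dk; rewrite /w /=; clear -sx0 a0; lra.
  apply: (@goursat_punctured _ _ _ _ _ w (Num.max (`|B| / a) (2 * C / (d * a)))).
  - by rewrite /w /=; clear -a0 aL; lra.
  - by rewrite /w /=; clear -a0 aL; lra.
  move=> z /andP[h _] _ zw; split; first exact: dF.
  rewrite le_max; have [zd|zd] := ltP (cabs (z - w)) d; apply/orP; [left|right].
    have zw0 : 0 < cabs (z - w) by rewrite cabs_gt0 subr_eq0.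
    rewrite /F cabsM cabsV cabsM invfM mulrA ler_pM ?invr_ge0 ?cabs_ge0//.
    - by rewrite divr_ge0 ?cabs_ge0.
    - rewrite ler_pdivrMr//; apply: (le_trans (hB z zd)).
      by rewrite ler_wpM2r ?cabs_ge0// ler_norm.
    - by rewrite lef_pV2 ?posrE ?zw'a// (lt_le_trans a0)// zw'a.
  by apply: FB => //; [exact: lt_le_trans h|exact: zw'a].
have Fl y : F (Complex x0 y) = k w * (poisson a b y)%:C%C -
    (poisson a b y)%:C%C * k (Complex x0 y).
  rewrite /F poisson_line// invrN.
  have -> : ((poisson a b y)^-1)%:C%C^-1 = (poisson a b y)%:C%C by rewrite fmorphV/= invrK.
  ring.
have iP : cintegrable `[b - L, b + L] (fun y => (poisson a b y)%:C%C).
  exact/cintegrable_real/poisson_integrable.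
have cPk := @poisson_mul_ccont_on k s x0 a b (b - L) (b + L) sx0 a0 dk.
have iPk := ccont_on_cintegrable cPk.
have iFl : cintegrable `[b - L, b + L] (fun y => F (Complex x0 y)).
  have := cintegrableB (measurable_itv _) (cintegrableZ (k w) (measurable_itv _) iP) iPk.
  by apply: eq_cintegrable => // y _; rewrite Fl.
have iFr : cintegrable `[b - L, b + L] (fun y => F (Complex (x0 + L) y)).
  apply/ccont_on_cintegrable/cdiff_ccont_vertical => y _; apply: dF => /=.
    by clear -L0; lra.
  by rewrite /w eq_complex /= negb_and gt_eqF//; clear -aL a0; lra.
have iFh (y : R) : y != b -> cintegrable `[x0, x0 + L] (fun x => F (Complex x y)).
  move=> yb; apply/ccont_on_cintegrable/cdiff_ccont_horizontal => x xx; apply: dF => /=.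
    by clear -xx; lra.
  by rewrite /w eq_complex /= negb_and yb orbT.
set I := \int[mu]_(y in _) poisson a b y.
have E : cint `[b - L, b + L] (fun y => F (Complex x0 y)) =
    k w * I%:C%C - cint `[b - L, b + L] (fun y => (poisson a b y)%:C%C * k (Complex x0 y)).
  rewrite /I -cint_real -cintZ// -cintB//; last exact: cintegrableZ.
  by apply: eq_cint => y _; rewrite Fl.
have I0 : 0 <= I by apply: Rintegral_ge0 => y _; exact: poisson_ge0.
have hPk : cabs (cint `[b - L, b + L] (fun y => (poisson a b y)%:C%C * k (Complex x0 y))) <=
    \int[mu]_(y in `[b - L, b + L]) (poisson a b y * cabs (k (Complex x0 y))).
  apply: ler_cabs_cint => //.
    have := rcont_on_integrable (ccont_on_cabs cPk); apply: eq_integrable => // y _ /=.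
    by rewrite cabsM cabs_real ger0_norm// poisson_ge0.
  by move=> y _; rewrite cabsM cabs_real ger0_norm// poisson_ge0.
have bLn : b - L != b /\ b + L != b.
  by split; [rewrite lt_eqF//|rewrite gt_eqF//]; clear -L0; lra.
have hh : cabs (cint `[x0, x0 + L]
    (fun x => F (Complex x (b - L)) - F (Complex x (b + L)))) <= 4 * C / L.
  rewrite (_ : 4 * C / L = 2 * (2 * C / (L * L)) * (x0 + L - x0)); last first.
    by field; rewrite gt_eqF.
  apply: ler_cabs_cint_itv; [clear -L0; lra|by apply: cintegrableB => //; apply: iFh; case: bLn|].
  have hF x (y : R) : x0 <= x -> L <= `|y - b| -> cabs (F (Complex x y)) <= 2 * C / (L * L).
    move=> x0x yb; apply: FB => //=; first exact: lt_le_trans x0x.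
      by apply: le_trans yb _; apply: le_trans (ler_Im_cabs _); rewrite ImB.
    by apply: le_trans yb _; apply: le_trans (ler_Im_cabs _); rewrite ImB.
  move=> x /andP[x0x _]; apply: (le_trans (ler_cabsB _ _)).
  rewrite mulr_natl mulr2n lerD// hF//.
    by rewrite addrAC subrr add0r normrN ler_norm.
  by rewrite addrAC subrr add0r ler_norm.
have hr : cabs (cint `[b - L, b + L] (fun y => F (Complex (x0 + L) y))) <= 8 * C / L.
  rewrite (_ : 8 * C / L = (2 * C / (L / 2 * L)) * (b + L - (b - L))); last first.
    by field; rewrite gt_eqF.
  apply: ler_cabs_cint_itv => //; first by clear -L0; lra.
  move=> y _; apply: FB => //=; [clear -sx0 L0; lra|by rewrite divr_gt0| | ];
    apply: le_trans (ler_Re_cabs _); apply: le_trans (ler_norm _); rewrite ReB /=;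
    clear -a0 aL; lra.
have : cabs (cint `[b - L, b + L] (fun y => F (Complex x0 y))) <= 12 * C / L.
  move: F0; rewrite /rect_int (cintB (D := `[b - L, b + L]))//.
  set H := cint `[x0, x0 + L] _ in hh *; set V := cint _ (fun y => F (Complex (x0 + L) y)) in hr *.
  set W := cint _ _ => F0.
  have : Complex 0 1 * W = H + Complex 0 1 * V.
    by rewrite -[RHS]subr0 -F0; ring.
  move/(congr1 (@cabs R)); rewrite cabsM cabs_i mul1r => ->.
  apply: (le_trans (ler_cabsD _ _)); rewrite cabsM cabs_i mul1r.
  by rewrite (_ : 12 * C / L = 4 * C / L + 8 * C / L) ?lerD//; ring.
rewrite E => h.
have : cabs (k w) * I = cabs (k w * I%:C%C) by rewrite cabsM cabs_real ger0_norm.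
move=> ->; rewrite -[X in cabs X](subrK (cint `[b - L, b + L]
  (fun y => (poisson a b y)%:C%C * k (Complex x0 y)))).
by apply: (le_trans (ler_cabsD _ _)); rewrite addrC lerD.
Qed.

End PoissonInequality.

(** * Maximum principle, Schwarz lemma and Blaschke bounds in a half-plane *)

Section MaximumPrinciple.
Context {R : realType}.
Notation mu := (@lebesgue_measure R).
Implicit Types (k Q : R[i] -> R[i]) (a z w : R[i]) (s t : seq R[i]).

Lemma poisson_mul_integrable k (s0 x0 a b c d : R) : s0 < x0 -> 0 < a ->
  (forall z, s0 < complex.Re z -> cdiff k z) ->
  mu.-integrable `[c, d] (EFin \o (fun y => poisson a b y * cabs (k (Complex x0 y)))).
Proof.
move=> sx0 a0 dk.
have := rcont_on_integrable (ccont_on_cabs (@poisson_mul_ccont_on R k s0 x0 a b c d sx0 a0 dk)).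
apply: eq_integrable => // y _ /=.
by rewrite cabsM cabs_real ger0_norm// poisson_ge0.
Qed.

(** The a priori bound [C] enters only through the error [12 C / L], which vanishes for large [L];
    then the Poisson mass cancels. *)
Lemma max_principle k (s0 C B x0 : R) w : s0 < x0 -> x0 < complex.Re w ->
  (forall z, s0 < complex.Re z -> cdiff k z) ->
  (forall z, s0 < complex.Re z -> cabs (k z) <= C) ->
  (forall y, cabs (k (Complex x0 y)) <= B) -> cabs (k w) <= B.
Proof.
move=> sx0 xw dk kC kB; rewrite leNgt; apply/negP => Bw.
pose a := complex.Re w - x0; pose b := complex.Im w.
have a0 : 0 < a by rewrite subr_gt0.
have wE : w = Complex (x0 + a) b.
  by case: w @a @b {xw Bw a0} => p q /=; rewrite addrC subrK.
have C0 : 0 <= C by apply: le_trans (kC w (lt_trans sx0 xw)); exact: cabs_ge0.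
have D0 : 0 < cabs (k w) - B by rewrite subr_gt0.
(* Chosen so that [(cabs (k w) - B) / a * L] exceeds [12 * C]. *)
pose L := 2 * a + (12 * C + 1) * a / (cabs (k w) - B).
have aL : 2 * a <= L.
  by rewrite lerDl divr_ge0// ?ltW// mulr_gt0//; clear -C0; lra.
have L0 : 0 < L by apply: lt_le_trans aL; rewrite mulr_gt0.
have := poisson_ineq b sx0 a0 aL dk kC; rewrite -wE.
set I := (X in _ * X <= _ -> _) => h.
have I0 : a^-1 <= I.
  by apply: poisson_mass => //; apply: le_trans aL; clear -a0; lra.
have hB : \int[mu]_(y in `[b - L, b + L]) (poisson a b y * cabs (k (Complex x0 y))) <= B * I.
  rewrite /I -RintegralZl//; last exact: poisson_integrable.
  apply: le_Rintegral => //; first exact: (poisson_mul_integrable _ _ _ sx0 a0 dk).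
    exact: (integrableZl _ B (poisson_integrable b (b - L) (b + L) a0)).
  by move=> y _; rewrite mulrC ler_wpM2r ?poisson_ge0.
have {hB}h : (cabs (k w) - B) * I <= 12 * C / L.
  by rewrite mulrBl lerBlDl; apply: (le_trans h); rewrite lerD2r.
have : (cabs (k w) - B) * a^-1 * L <= 12 * C.
  by rewrite -ler_pdivlMr//; apply: le_trans h; rewrite ler_wpM2l// ltW.
rewrite /L mulrDr.
have -> : (cabs (k w) - B) / a * ((12 * C + 1) * a / (cabs (k w) - B)) = 12 * C + 1.
  by field; rewrite !gt_eqF.
have : 0 <= (cabs (k w) - B) / a * (2 * a) by rewrite mulr_ge0 ?divr_ge0 ?ltW// mulr_gt0.
by move: (_ / a * (2 * a)) => u; clear; lra.
Qed.

Lemma exp_bernoulli (r : R) n : 0 <= r -> 1 + n%:R * r <= (1 + r) ^+ n.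
Proof.
move=> r0; elim: n => [|n IH]; first by rewrite mul0r addr0 expr0.
rewrite exprSr; apply: (@le_trans _ _ ((1 + n%:R * r) * (1 + r))).
  rewrite -natr1; have : 0 <= n%:R * r * r by rewrite !mulr_ge0.
  by move: (n%:R) => u; clear; lra.
by rewrite ler_wpM2r// addr_ge0.
Qed.

(** A substitute for [n]-th roots: if [A > C], Bernoulli's inequality makes [(A / C) ^ n] outgrow
    the fixed constant [M / q]. *)
Lemma ler_of_expr (A C M q : R) : 0 < C -> 0 < q ->
  (forall n, A ^+ n * q <= C ^+ n * M) -> A <= C.
Proof.
move=> C0 q0 h; rewrite leNgt; apply/negP => CA.
have r0 : 0 < A / C - 1 by rewrite subr_gt0 ltr_pdivlMr// mul1r.
pose n := Num.bound (`|M| / (q * (A / C - 1))).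
have hn : `|M| / (q * (A / C - 1)) < n%:R.
  by apply: archi_boundP; rewrite divr_ge0// mulr_ge0// ltW.
have := h n; rewrite -ler_pdivrMl ?exprn_gt0// mulrA (mulrC (_ ^-1)) -expr_div_n.
have := exp_bernoulli n (ltW r0); rewrite (addrC 1 (_ - 1)) subrK => hb h'.
move: hn; rewrite ltr_pdivrMr ?mulr_gt0// (mulrC q) mulrA => hn.
have : (n%:R * (A / C - 1) + 1) * q <= M.
  by apply: le_trans h'; rewrite ler_wpM2r ?(ltW q0)// addrC.
have := ler_norm M; move: hn; rewrite mulrDl mul1r.
by move: (n%:R * _ * q) (`|M|) => u v; clear -q0; lra.
Qed.

(** A quadratic bound forces derivative [0], whatever [k] does elsewhere. It yields
    differentiability at points where only boundedness of a factor is known. *)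
Lemma cdiff_quadratic k z A d : 0 < d -> k z = 0 ->
  (forall w, cabs (w - z) < d -> cabs (k w) <= A * cabs (w - z) ^+ 2) -> cdiff k z.
Proof.
move=> d0 kz h; apply/cdiffP; exists 0 => e e0.
have A0 : 0 < `|A| + 1 by rewrite ltr_wpDl.
exists (Num.min d (e / (`|A| + 1))); first by rewrite lt_min d0 divr_gt0.
move=> w; rewrite lt_min ltr_pdivlMr// => /andP[wd we].
rewrite kz mul0r !subr0; apply: (le_trans (h w wd)).
rewrite expr2 mulrA ler_wpM2r ?cabs_ge0//; apply: le_trans (ltW we).
rewrite mulrC ler_wpM2l ?cabs_ge0//.
by have := ler_norm A; clear; lra.
Qed.

(** The squares are there for [cdiff_quadratic]; the denominators [z + 1] keep the product bounded
    on the half-plane. *)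
Definition zero_product t z := \prod_(u <- t) ((z - u) / (z + 1)) ^+ 2.

Lemma rhp_addr1_ge1 z : 0 <= complex.Re z -> 1 <= cabs (z + 1).
Proof.
move=> z0; apply: le_trans (ler_Re_cabs _); apply: le_trans (ler_norm _).
by rewrite ReD /= lerDr.
Qed.

Lemma rhp_addr1_neq0 z : 0 <= complex.Re z -> z + 1 != 0.
Proof. by move=> /rhp_addr1_ge1 h; rewrite -cabs_gt0; apply: lt_le_trans h. Qed.

Lemma zero_product_neq0 t z : 0 <= complex.Re z -> (zero_product t z == 0) = (z \in t).
Proof.
move=> z0; rewrite /zero_product; elim: t => [|u t IH]; first by rewrite big_nil oner_eq0.
rewrite big_cons mulf_eq0 IH expf_eq0 /= mulf_eq0 invr_eq0 (negbTE (rhp_addr1_neq0 z0)) orbF.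
by rewrite subr_eq0 in_cons.
Qed.

Lemma zero_product_bound t : exists2 M, 0 <= M & forall z, 0 <= complex.Re z -> cabs (zero_product t z) <= M.
Proof.
elim: t => [|u t [M M0 hM]].
  by exists 1 => // z _; rewrite /zero_product big_nil cabs1.
exists ((1 + cabs (1 + u)) ^+ 2 * M); first by rewrite mulr_ge0// sqr_ge0.
move=> z z0; rewrite /zero_product big_cons cabsM ler_pM ?cabs_ge0//; last exact: hM.
rewrite cabsX ler_pXn2r ?nnegrE ?cabs_ge0 ?addr_ge0 ?cabs_ge0//.
rewrite cabsM cabsV ler_pdivrMr; last by rewrite cabs_gt0 rhp_addr1_neq0.
rewrite (_ : z - u = (z + 1) - (1 + u)); last by ring.
apply: (le_trans (ler_cabsB _ _)); rewrite mulrDl mul1r lerD2l.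
by rewrite ler_peMr ?cabs_ge0// rhp_addr1_ge1.
Qed.

Lemma zero_product_cdiff t z : 0 <= complex.Re z -> cdiff (zero_product t) z.
Proof.
move=> z0; elim: t => [|u t IH].
  by rewrite /zero_product; under eq_fun do rewrite big_nil; exact: cdiff_cst.
rewrite /zero_product; under eq_fun do rewrite big_cons; apply: cdiffM IH.
apply/cdiffX/cdiff_div; [exact: rhp_addr1_neq0|exact: cdiff_subr|exact: cdiff_addr].
Qed.

Lemma zero_product_quadratic t u : u \in t -> exists2 M, 0 <= M &
  forall z, 0 <= complex.Re z -> cabs (zero_product t z) <= M * cabs (z - u) ^+ 2.
Proof.
elim: t => [//|v t IH]; rewrite in_cons => /orP[/eqP <-|/IH[M M0 hM]].
  have [M M0 hM] := zero_product_bound t; exists M => // z z0.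
  rewrite /zero_product big_cons cabsM mulrC ler_pM ?cabs_ge0 ?hM//.
  rewrite cabsX ler_pXn2r ?nnegrE ?cabs_ge0// cabsM cabsV ler_piMr ?cabs_ge0//.
  by rewrite invf_le1 ?rhp_addr1_ge1// cabs_gt0 rhp_addr1_neq0.
have [N N0 hN] := zero_product_bound [:: v]; exists (N * M); first by rewrite mulr_ge0.
move=> z z0; rewrite /zero_product big_cons cabsM -mulrA ler_pM ?cabs_ge0 ?hM//.
by have := hN z z0; rewrite /zero_product big_seq1.
Qed.

(* The square factors cancel the possible singularities, and taking high powers of
   [Q] makes their contribution negligible. *)
Lemma max_principle_punctured Q t (s0 B C x0 : R) w : 0 <= s0 -> s0 < x0 ->
  x0 < complex.Re w -> w \notin t ->
  (forall z, s0 < complex.Re z -> z \notin t -> cdiff Q z /\ cabs (Q z) <= B) ->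
  (forall y, Complex x0 y \notin t -> cabs (Q (Complex x0 y)) <= C) ->
  cabs (Q w) <= C.
Proof.
move=> s00 sx0 xw wt hQ hC; have w0 : s0 < complex.Re w by exact: lt_trans xw.
have B0 : 0 <= B by have [_] := hQ w w0 wt; apply: le_trans; exact: cabs_ge0.
(* The sign of [C] is not known yet, and the argument by powers needs a positive bound. *)
apply/ler_addgt0Pl => e e0; rewrite addrC; set C' := Num.max C 0 + e.
suff : cabs (Q w) <= C'.
  rewrite /C'; have [C0|C0] := leP 0 C; first by [].
  (* A negative [C] is absurd once the line has a point outside [t]; an ordinate exceeding every
     [|Im u|] provides one. *)
  have : exists y, Complex x0 y \notin t.
    pose y := 1 + \sum_(u <- t) `|complex.Im u|; exists y; apply/negP => yt.
    have : `|y| <= \sum_(u <- t) `|complex.Im u|.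
      rewrite (big_rem _ yt) /= lerDl.
      by apply: sumr_ge0.
    rewrite ger0_norm /y; first by rewrite gerDr ler10.
    by rewrite addr_ge0// sumr_ge0.
  move=> [y /hC]; have := cabs_ge0 (Q (Complex x0 y)) => h1 h2.
  by have := le_trans h1 h2; rewrite leNgt C0.
have C'0 : 0 < C' by rewrite ltr_wpDl// le_max lexx orbT.
have hC' y : Complex x0 y \notin t -> cabs (Q (Complex x0 y)) <= C'.
  by move=> /hC h; rewrite /C' -(addr0 (cabs _)) lerD ?le_max ?h// ltW.
have [M M0 hM] := zero_product_bound t.
have [p0 pw] : 0 <= complex.Re w /\ 0 < cabs (zero_product t w).
  have h : 0 <= complex.Re w by apply/ltW/(le_lt_trans s00).
  by rewrite h cabs_gt0 zero_product_neq0.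
apply: (ler_of_expr C'0 pw (M := M)) => n.
pose W z := Q z ^+ n * zero_product t z.
have z0 z : s0 < complex.Re z -> 0 <= complex.Re z by move=> h; apply/ltW/(le_lt_trans s00).
have wt0 z : s0 < complex.Re z -> z \in t -> zero_product t z = 0.
  by move=> /z0 h zt; apply/eqP; rewrite zero_product_neq0.
have WB (D : R) z : s0 < complex.Re z -> 0 <= D -> (z \notin t -> cabs (Q z) <= D) ->
    cabs (W z) <= D ^+ n * cabs (zero_product t z).
  move=> sz D0 hD; rewrite /W cabsM; have [zt|zt] := boolP (z \in t).
    by rewrite (wt0 z)// cabs0 !mulr0.
  rewrite cabsX ler_wpM2r ?cabs_ge0//; case: n {W} => [|n]; first by rewrite !expr0.
  by rewrite ler_pXn2r ?nnegrE ?cabs_ge0// hD.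
have -> : cabs (Q w) ^+ n * cabs (zero_product t w) = cabs (W w) by rewrite /W cabsM cabsX.
apply: (@max_principle W s0 (B ^+ n * M) (C' ^+ n * M) x0) => // [z sz|z sz|y].
- have [zt|zt] := boolP (z \in t); last first.
    by apply: cdiffM; [apply: cdiffX; case: (hQ z sz zt)|apply: zero_product_cdiff; exact: z0].
  have [N N0 hN] := zero_product_quadratic zt.
  apply: (@cdiff_quadratic _ _ (B ^+ n * N) (complex.Re z - s0)).
  + by rewrite subr_gt0.
  + by rewrite /W (wt0 z) ?mulr0.
  move=> v vz; have sv : s0 < complex.Re v.
    have := ler_Re_cabs (v - z); rewrite ReB ler_norml => /andP[h _].
    by clear -h vz; lra.
  apply: (le_trans (WB B v sv B0 _)); first by move=> vt; case: (hQ v sv vt).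
  by rewrite -mulrA ler_wpM2l ?exprn_ge0// hN// z0.
- apply: (le_trans (WB B z sz B0 _)); first by move=> zt; case: (hQ z sz zt).
  by rewrite ler_wpM2l ?exprn_ge0// hM// z0.
- have h := WB C' (Complex x0 y) sx0 (ltW C'0) (hC' y); apply: (le_trans h).
  by rewrite ler_wpM2l ?exprn_ge0 ?(ltW C'0)// hM// z0.
Qed.

(** Points of a line are equidistant from [w] and from its mirror image [2 x0 - conjc w]. *)
Lemma cabs_reflect (x0 : R) z w : complex.Re z = x0 ->
  cabs (z + conjc w - (2 * x0)%:C%C) = cabs (z - w).
Proof.
case: z w => p q [u v] /= ->; rewrite /cabs /=; congr Num.sqrt; ring.
Qed.

(** The quotient of [k] by the Blaschke factor of [a] obeys the same bound [C]. The list [s] allows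
    iteration: after a division by [z - u], the value at [u] is the default of division by zero and
    carries no information. *)
Lemma schwarz_half_plane k s C a w :
  (forall z, 0 < complex.Re z -> z \notin s -> cdiff k z /\ cabs (k z) <= C) ->
  0 < complex.Re a -> a \notin s -> k a = 0 -> 0 < complex.Re w -> w \notin a :: s ->
  cabs (k w) * cabs (w + conjc a) <= C * cabs (w - a).
Proof.
move=> hk a0 as_ ka w0 ws; apply/ler_addgt0Pr => e e0.
have kw0 : 0 < 2 * cabs (k w) + 1 by rewrite ltr_wpDl// mulr_ge0// cabs_ge0.
have [|x0 x00 /=] := @exists_small R [:: complex.Re w / 2; complex.Re a / 2;
    e / (2 * cabs (k w) + 1)].
  by rewrite /= !divr_gt0.
move=> /and3P[xw xa]; rewrite andbT ler_pdivlMr// => xe.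
have {}xw : x0 < complex.Re w by apply: (le_lt_trans xw); clear -w0; lra.
have {}xa : x0 < complex.Re a by apply: (le_lt_trans xa); clear -a0; lra.
have [wa wNs] : w - a != 0 /\ w \notin s.
  by move: ws; rewrite in_cons negb_or subr_eq0 => /andP.
have C0 : 0 <= C by have [_] := hk w w0 wNs; apply: le_trans; exact: cabs_ge0.
(* Reflecting [a] in [Re z = x0] instead of the imaginary axis makes the moduli of [Q] and [k] agree
   on that line. The resulting discrepancy [2 x0 * cabs (k w)] is absorbed by [e]. *)
pose Q z := k z * (z + conjc a - (2 * x0)%:C%C) / (z - a).
suff : cabs (Q w) <= C.
  rewrite /Q cabsM cabsV cabsM ler_pdivrMr ?cabs_gt0// => h.
  rewrite (_ : w + conjc a = (w + conjc a - (2 * x0)%:C%C) + (2 * x0)%:C%C); last by ring.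
  apply: (le_trans (ler_wpM2l (cabs_ge0 _) (ler_cabsD _ _))); rewrite mulrDr lerD//.
  rewrite cabs_real ger0_norm; last by rewrite mulr_ge0// ltW.
  by move: xe; rewrite mulrDr mulr1 mulrCA mulrA (mulrC 2) -mulrA mulrCA; clear -x00; lra.
have [B [d d0 hB]] : exists B, exists2 d, 0 < d &
    forall z, cabs (z - a) < d -> cabs (k z) <= B * cabs (z - a).
  have [dk _] := hk a a0 as_; have [B [d d0 hB]] := cdiff_lipschitz dk.
  by exists B, d => // z /hB; rewrite ka subr0.
pose m := cabs (a + conjc a - (2 * x0)%:C%C).
have hm z : cabs (z + conjc a - (2 * x0)%:C%C) <= cabs (z - a) + m.
  by rewrite (_ : z + _ - _ = (z - a) + (a + conjc a - (2 * x0)%:C%C)) ?ler_cabsD//; ring.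
have hs z : 0 < complex.Re z -> z \notin a :: s ->
    [/\ cdiff k z, cabs (k z) <= C & 0 < cabs (z - a)].
  rewrite in_cons negb_or -subr_eq0 => z0 /andP[za zs].
  by have [dk kC] := hk z z0 zs; rewrite cabs_gt0 za.
apply: (@max_principle_punctured Q (a :: s) (x0 / 2)
   (Num.max (`|B| * (d + m)) (C * (1 + m / d))) C x0) => //.
- by rewrite divr_ge0// ltW.
- by clear -x00; lra.
- move=> z xz zs; have z0 : 0 < complex.Re z by clear -xz x00; lra.
  have [dk kC za] := hs z z0 zs.
  split.
    apply: cdiff_div; [by rewrite -cabs_gt0| |exact: cdiff_subr].
    apply: cdiffM; first exact: dk.
    by under eq_fun do rewrite -addrA; exact: cdiff_addr.
  rewrite /Q cabsM cabsM cabsV le_max; apply/orP.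
  have [zd|zd] := ltP (cabs (z - a)) d; [left|right].
    rewrite ler_pdivrMr// mulrAC ler_pM ?cabs_ge0//.
      by apply: (le_trans (hB z zd)); rewrite ler_wpM2r ?cabs_ge0// ler_norm.
    by apply: (le_trans (hm z)); rewrite lerD2r ltW.
  rewrite -mulrA ler_pM ?cabs_ge0 ?divr_ge0 ?cabs_ge0// ler_pdivrMr//.
  apply: (le_trans (hm z)); rewrite mulrDl mul1r lerD2l.
  by rewrite mulrAC ler_pdivlMr// ler_wpM2l ?cabs_ge0.
- move=> y ys; have [dk kC za] := hs (Complex x0 y) x00 ys.
  by rewrite /Q cabsM cabsM cabsV cabs_reflect// mulfK// gt_eqF.
Qed.

(** By induction: dividing out the factor of one zero keeps the bound [C], by [schwarz_half_plane],
    and moves that zero to the exceptional list. *)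
Lemma blaschke_bound k s C (zs : seq R[i]) w :
  (forall z, 0 < complex.Re z -> z \notin s -> cdiff k z /\ cabs (k z) <= C) ->
  uniq zs -> (forall z, z \in zs -> [/\ 0 < complex.Re z, z \notin s & k z = 0]) ->
  0 < complex.Re w -> w \notin zs -> w \notin s ->
  cabs (k w) <= C * \prod_(z <- zs) (cabs (w - z) / cabs (w + conjc z)).
Proof.
elim: zs k s => [|a zs IH] k s hk.
  by move=> _ _ w0 _ ws; rewrite big_nil mulr1; case: (hk w w0 ws).
move=> /= /andP[azs uzs] hzs w0; rewrite in_cons negb_or => /andP[wa wzs] ws.
have [a0 as_ ka] := hzs a (mem_head _ _).
pose k1 z := k z * (z + conjc a) / (z - a).
have conj0 z : 0 < complex.Re z -> z + conjc a != 0.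
  move=> z0; rewrite -cabs_gt0; apply: lt_le_trans (ler_Re_cabs _).
  by rewrite ReD Re_conjc gtr0_norm addr_gt0.
have {}IH := IH k1 (a :: s).
have : cabs (k1 w) <= C * \prod_(z <- zs) (cabs (w - z) / cabs (w + conjc z)).
  apply: IH => //.
  - move=> z z0; rewrite in_cons negb_or => /andP[za zs'].
    have [dk kC] := hk z z0 zs'; split.
      apply: cdiff_div; [by rewrite subr_eq0| |exact: cdiff_subr].
      by apply: cdiffM; [exact: dk|exact: cdiff_addr].
    rewrite /k1 cabsM cabsM cabsV ler_pdivrMr ?cabs_gt0 ?subr_eq0//.
    by apply: (schwarz_half_plane hk) => //; rewrite in_cons negb_or za.
  - move=> z zzs; have [|z0 zs' kz] := hzs z; first by rewrite in_cons zzs orbT.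
    split => //; last by rewrite /k1 kz !mul0r.
    rewrite in_cons negb_or zs' andbT; apply: contraNneq azs => <-.
    exact: zzs.
  - by rewrite in_cons negb_or wa.
rewrite big_cons mulrCA /k1 cabsM cabsV cabsM => h.
have wa' : 0 < cabs (w - a) by rewrite cabs_gt0 subr_eq0.
have wca : 0 < cabs (w + conjc a) by rewrite cabs_gt0 conj0.
by rewrite -ler_pdivrMl ?divr_gt0// invf_div mulrC mulrA.
Qed.

Lemma cabs_blaschke w z : cabs (w - z) ^+ 2 =
  cabs (w + conjc z) ^+ 2 - 4 * complex.Re w * complex.Re z.
Proof. by rewrite !sqr_cabs; case: w z => p q [u v] /=; ring. Qed.

Lemma harmonic_unbounded (M : R) : exists n, M < \sum_(j < n) (j.+1%:R)^-1.
Proof.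
apply: contrapT => h; apply: (@dvg_harmonic R).
apply: nondecreasing_is_cvgn.
  apply/nondecreasing_seqP => n; rewrite /series /= big_nat_recr//= lerDl.
  by rewrite invr_ge0.
exists M => _ [n _ <-]; rewrite leNgt; apply/negP => Mn; apply: h; exists n.
by rewrite /series /= big_mkord in Mn.
Qed.

(** Shows without logarithms that the product tends to zero; the inductive step is
    [(1 - u) (1 + v + u) <= 1 + v] for [u, v >= 0]. *)
Lemma prod_sqr_harmonic (c : R) (rho : nat -> R) N : 0 <= c ->
  (forall j, rho j ^+ 2 <= 1 - c / j.+1%:R) ->
  (\prod_(j < N) rho j) ^+ 2 * (1 + c * \sum_(j < N) (j.+1%:R)^-1) <= 1.
Proof.
move=> c0 h; elim: N => [|N IH]; first by rewrite !big_ord0 mulr0 addr0 expr1n mulr1.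
rewrite !big_ord_recr /= exprMn.
set P := (\prod_(i < N) _) ^+ 2 in IH *; set S := \sum_(i < N) _ in IH *.
have P0 : 0 <= P by exact: sqr_ge0.
have S0 : 0 <= S by apply: sumr_ge0 => i _; rewrite invr_ge0.
have u0 : 0 <= c / N.+1%:R by rewrite divr_ge0.
rewrite [c * (S + _)]mulrDr -mulrA; apply: le_trans IH; rewrite ler_wpM2l//.
apply: (@le_trans _ _ ((1 - c / N.+1%:R) * (1 + (c * S + c / N.+1%:R)))).
  by rewrite ler_wpM2r// !addr_ge0// mulr_ge0.
have : 0 <= c / N.+1%:R * (c * S) by rewrite !mulr_ge0.
have : 0 <= c / N.+1%:R * (c / N.+1%:R) by rewrite mulr_ge0.
by move: (c / _) (c * S) => u v; clear; lra.
Qed.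

(** By [cabs_blaschke], the squared Blaschke factor of [zs j] at [w] is [1 - 4 Re w Re (zs j) / |w +
    conj (zs j)| ^ 2]. The hypothesis on [c] bounds the subtracted term below by a multiple of
    [1 / (j + 1)], so the Blaschke sum diverges. *)
Lemma blaschke_uniqueness k C (zs : nat -> R[i]) w (c : R) :
  (forall z, 0 < complex.Re z -> cdiff k z) ->
  (forall z, 0 < complex.Re z -> cabs (k z) <= C) ->
  injective zs -> (forall j, 0 < complex.Re (zs j) /\ k (zs j) = 0) ->
  0 < c -> (forall j, c / j.+1%:R * cabs (w + conjc (zs j)) ^+ 2 <= complex.Re (zs j)) ->
  0 < complex.Re w -> k w = 0.
Proof.
move=> dk kC zinj hz c0 hc w0.
have [[j <-]|wz] := pselect (exists j, zs j = w); first by have [] := hz j.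
apply/eqP/negP => /negP; rewrite -cabs_gt0 => kw0.
have C0 : 0 < C by apply: (lt_le_trans kw0); exact: kC.
pose rho j := cabs (w - zs j) / cabs (w + conjc (zs j)).
have d0 j : 0 < cabs (w + conjc (zs j)).
  apply: lt_le_trans (ler_Re_cabs _); rewrite ReD Re_conjc gtr0_norm addr_gt0//;
  by have [] := hz j.
pose c' := 4 * complex.Re w * c.
have c'0 : 0 < c' by rewrite !mulr_gt0.
have hrho j : rho j ^+ 2 <= 1 - c' / j.+1%:R.
  rewrite /rho expr_div_n cabs_blaschke ler_pdivrMr ?exprn_gt0//.
  rewrite mulrBl mul1r lerD2l lerN2 /c' -!mulrA ler_wpM2l// ler_wpM2l ?(ltW w0)//.
  by rewrite mulrA.
have bound N : cabs (k w) <= C * \prod_(j < N) rho j.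
  have := @blaschke_bound k [::] C (map zs (index_iota 0 N)) w.
  rewrite big_map big_mkord; apply => //.
  - by move=> z z0 _; split; [exact: dk|exact: kC].
  - by rewrite map_inj_uniq// iota_uniq.
  - by move=> _ /mapP[j _ ->]; have [] := hz j.
  - by apply/mapP => -[j _ E]; apply: wz; exists j.
have [N] := harmonic_unbounded ((C / cabs (k w)) ^+ 2 / c').
rewrite ltr_pdivrMr// [_ * c']mulrC => hN.
have := prod_sqr_harmonic N (ltW c'0) hrho.
have hP : cabs (k w) / C <= \prod_(j < N) rho j by rewrite ler_pdivrMr// mulrC.
have : (cabs (k w) / C) ^+ 2 <= (\prod_(j < N) rho j) ^+ 2.
  by rewrite ler_pXn2r ?nnegrE ?divr_ge0 ?cabs_ge0 ?(ltW C0)//; apply: le_trans hP;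
    rewrite divr_ge0 ?cabs_ge0// ltW.
have q0 : 0 < (cabs (k w) / C) ^+ 2 by rewrite exprn_gt0// divr_gt0.
move: hN; rewrite -[C / _]invf_div exprVn; move: (_ / C) q0 => q q0 hN h1 h2.
have : q ^+ 2 * (1 + c' * \sum_(j < N) (j.+1%:R)^-1) <= 1.
  apply: le_trans h2; rewrite ler_wpM2r// addr_ge0// mulr_ge0 ?(ltW c'0)//.
  by apply: sumr_ge0 => i _; rewrite invr_ge0.
rewrite leNgt => /negP; apply; rewrite mulrDr mulr1 ltr_wpDl ?(ltW q0)//.
by rewrite -ltr_pdivrMl// mulr1.
Qed.

End MaximumPrinciple.

(** * Pointwise bounds for functions in [H^1] *)

Section HardyBound.
Context {R : realType}.
Notation mu := (@lebesgue_measure R).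
Implicit Types (f g k : R[i] -> R[i]) (a z w : R[i]).

Lemma H1_rhp_cdiff g z : H1_rhp g -> 0 < complex.Re z -> cdiff g z.
Proof. by move=> [hg _]; exact: hg. Qed.

Lemma H1_rhp_line_continuous g (x : R) : H1_rhp g -> 0 < x ->
  continuous (fun y => cabs (g (Complex x y))).
Proof.
move=> hg x0 y; apply/cvgrPdist_lt => e e0.
have dg : cdiff g (Complex x y) by exact: H1_rhp_cdiff.
have [d d0 hd] := cdiff_continuous dg e0.
apply/nbhs_ballP; exists d => //= y'; rewrite /ball /= distrC => yd.
have := hd (Complex x y'); rewrite cabs_vertical => /(_ yd).
apply: le_lt_trans; rewrite ler_norml.
have := lerB_cabsB (g (Complex x y)) (g (Complex x y')).
have := lerB_cabsB (g (Complex x y')) (g (Complex x y)).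
rewrite (cabsC (g (Complex x y))).
by move: (cabs (_ - _)) (cabs _) (cabs _) => u v v'; clear; lra.
Qed.

Lemma H1_rhp_integrable g (x : R) : H1_rhp g -> 0 < x ->
  mu.-integrable setT (EFin \o (fun y => cabs (g (Complex x y)))).
Proof.
move=> hg x0; have cg := H1_rhp_line_continuous hg x0.
have mg : measurable_fun setT (fun y : measurableTypeR R => cabs (g (Complex x y))).
  exact: (continuous_measurable_fun cg).
apply/integrableP; split; first exact: (measurableT_comp _ mg).
have [_ [M hM]] := hg.
under eq_integral do rewrite /= ger0_norm ?cabs_ge0//.
by apply: (@le_lt_trans _ _ M%:E); [exact: hM|exact: ltry].
Qed.

Lemma Rintegral_subset (D : set (measurableTypeR R)) (u : R -> R) : measurable D ->
  (forall y, 0 <= u y) -> mu.-integrable setT (EFin \o u) ->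
  \int[mu]_(y in D) u y <= \int[mu]_y u y.
Proof.
move=> mD u0 iu; rewrite /Rintegral fine_le//.
- by apply: integrable_fin_num => //; apply: integrableS iu.
- exact: integrable_fin_num.
apply: ge0_subset_integral => //; last by move=> y _; rewrite lee_fin.
by apply: (measurable_int mu).
Qed.

Lemma H1_rhp_bound g : H1_rhp g -> exists2 M, 0 <= M & forall x, 0 < x ->
  \int[mu]_y cabs (g (Complex x y)) <= M.
Proof.
move=> hg; have [_ [M hM]] := hg; exists `|M| => // x x0.
apply: le_trans (ler_norm _); rewrite -lee_fin /Rintegral fineK; first exact: hM.
by apply: integrable_fin_num => //; exact: H1_rhp_integrable.
Qed.

(** The Schwarz lemma for [k - k a], bounded by [2 C], at [w = a + h]: the difference quotient is at
    most [2 C / |w + conj a| <= C / Re a]. *)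
Lemma derivative_bound k C a (D : R[i]) : 0 < complex.Re a ->
  (forall z, 0 < complex.Re z -> cdiff k z) ->
  (forall z, 0 < complex.Re z -> cabs (k z) <= C) ->
  (forall e, 0 < e -> exists2 d, 0 < d & forall w, cabs (w - a) < d ->
    cabs (k w - k a - D * (w - a)) <= e * cabs (w - a)) ->
  cabs D * complex.Re a <= C.
Proof.
move=> a0 dk kC hD; apply/ler_addgt0Pr => e e0.
have [|d d0 hd] := hD (e / complex.Re a); first by rewrite divr_gt0.
pose h := d / 2; have h0 : 0 < h by rewrite divr_gt0.
pose w := a + h%:C%C.
have wa : w - a = h%:C%C by rewrite /w addrAC subrr add0r.
have hw : cabs (w - a) = h by rewrite wa cabs_real gtr0_norm.
have {}hd : cabs (k w - k a - D * (w - a)) <= e / complex.Re a * h.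
  by rewrite -[in X in _ <= X]hw; apply: hd; rewrite hw /h; clear -d0; lra.
have Rew : complex.Re w = complex.Re a + h by rewrite ReD.
have w0 : 0 < complex.Re w by rewrite Rew addr_gt0.
have S : cabs (k w - k a) * cabs (w + conjc a) <= 2 * C * cabs (w - a).
  apply: (@schwarz_half_plane _ (fun z => k z - k a) [::]) => //.
  - move=> z z0 _; split; first by apply: cdiffB; [exact: dk|exact: cdiff_cst].
    apply: (le_trans (ler_cabsB _ _)); rewrite mulr_natl mulr2n.
    by apply: lerD; exact: kC.
  - by rewrite subrr.
  - by rewrite inE -subr_eq0 -cabs_eq0 hw gt_eqF.
have wca : 2 * complex.Re a <= cabs (w + conjc a).
  apply: le_trans (ler_Re_cabs _); apply: le_trans (ler_norm _).
  by rewrite ReD Re_conjc Rew; clear -h0; lra.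
have S2 : cabs (k w - k a) * complex.Re a <= C * h.
  have := le_trans (ler_wpM2l (cabs_ge0 (k w - k a)) wca) S; rewrite hw.
  by move: (cabs _) => u; clear; lra.
have T : cabs D * h <= cabs (k w - k a) + e / complex.Re a * h.
  have -> : cabs D * h = cabs (D * (w - a)) by rewrite cabsM hw.
  rewrite -(subrK (D * (w - a)) (k w - k a)) in S2 *.
  have := lerB_cabsB (k w - k a) (k w - k a - D * (w - a)).
  rewrite opprB addrCA subrr addr0 subrK.
  have := ler_cabsB (k w - k a) (k w - k a - D * (w - a)).
  rewrite (_ : k w - k a - (k w - k a - D * (w - a)) = D * (w - a)); last by ring.
  by move=> h1 _; apply: (le_trans h1); rewrite lerD2l.
have : cabs D * h * complex.Re a <= C * h + e * h.
  apply: (le_trans (ler_wpM2r (ltW a0) T)); rewrite mulrDl lerD//.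
  by rewrite mulrAC divfK// gt_eqF.
by rewrite -mulrDl mulrAC ler_pM2r.
Qed.

(** For a primitive [G] of [g], [K w] would be [- i (G (w + i s) - G w)]. No primitive is
    constructed: horizontal and vertical increments of [K] are estimated separately. *)
Lemma shift_primitive g (s : R) z : 0 < s -> 0 < complex.Re z ->
  (forall w, 0 < complex.Re w -> cdiff g w) ->
  let K w := cint `[complex.Im w, complex.Im w + s] (fun y => g (Complex (complex.Re w) y)) in
  forall e, 0 < e -> exists2 d, 0 < d & forall w, cabs (w - z) < d ->
    cabs (K w - K z - Complex 0 1 * (g z - g (z + Complex 0 s)) * (w - z)) <=
    e * cabs (w - z).
Proof.
move=> s0 z0 dg K e e0; case: z z0 => x y /= x0; set D := Complex 0 1 * _.
have zs : Complex x y + Complex 0 s = Complex x (y + s).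
  by apply/eqP; rewrite eq_complex /= addr0 !eqxx.
rewrite zs in D *.
(* Two values of [g] occur in each direction, and the horizontal and vertical increments together
   are at most twice [cabs (w - z)]. *)
have e40 : 0 < e / 4 by rewrite divr_gt0.
have [d1 d10 h1] := cdiff_continuous (dg (Complex x y) x0) e40.
have [d2 d20 h2] := cdiff_continuous (dg (Complex x (y + s)) x0) e40.
have [|d d0 /=] := @exists_small R [:: d1 / 2; d2 / 2; x / 2].
  by rewrite /= !divr_gt0.
move=> /and3P[dd1 dd2]; rewrite andbT => dx.
pose near_z (p q : R) := `|p - x| < d /\ `|q - y| < d.
have nx p q : near_z p q -> 0 < p.
  by rewrite /near_z ltr_norml => -[/andP[h _] _]; clear -h dx x0; lra.
have g1 p q : near_z p q -> cabs (g (Complex p q) - g (Complex x y)) <= e / 4.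
  move=> [hp hq]; apply/ltW/h1; apply: (le_lt_trans (ler_cabs_ReIm _)).
  by rewrite ReB ImB /=; clear -hp hq dd1; lra.
have g2 p q : near_z p q -> cabs (g (Complex p (q + s)) - g (Complex x (y + s))) <= e / 4.
  move=> [hp hq]; apply/ltW/h2; apply: (le_lt_trans (ler_cabs_ReIm _)).
  rewrite ReB ImB /= (_ : q + s - (y + s) = q - y); last by ring.
  by clear -hp hq dd2; lra.
have iv p c c' : 0 < p -> cintegrable `[c, c'] (fun t => g (Complex p t)).
  by move=> p0; apply/ccont_on_cintegrable/cdiff_ccont_vertical => t _; exact: dg.
have ih q c c' : 0 < c -> cintegrable `[c, c'] (fun t => g (Complex t q)).
  move=> c0; apply/ccont_on_cintegrable/cdiff_ccont_horizontal => t /andP[ct _].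
  by apply: dg; exact: lt_le_trans ct.
have between (u v t m : R) : u <= t <= v -> `|u - m| < d -> `|v - m| < d -> `|t - m| < d.
  by rewrite !ltr_norml; clear; lra.
(* Goursat's theorem replaces the difference of the two vertical integrals by integrals along the
   short bottom and top edges. *)
have hor p p' q : p <= p' -> near_z p q -> near_z p' q ->
    cabs (K (Complex p' q) - K (Complex p q) - D * (p' - p)%:C%C) <= e / 2 * (p' - p).
  move=> pp' npq np'q; have p0 := nx _ _ npq.
  have qs : q <= q + s by rewrite lerDl ltW.
  have np t : p <= t <= p' -> near_z t q.
    by case: npq np'q => [hp hq] [hp' _] ht; split=> //; exact: between ht hp hp'.
  have := @goursat _ g p p' q (q + s) pp' qs.
  have dgr : cdiff_rect g p p' q (q + s).
    by move=> t r /andP[pt _] _; apply: dg; exact: lt_le_trans pt.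
  move=> /(_ dgr); rewrite /rect_int (cintB (D := `[q, q + s]));
    [|by []|by apply: iv; exact: nx np'q|exact: iv].
  rewrite -/(K (Complex p' q)) -/(K (Complex p q)).
  set A := cint `[p, p'] _ => hA.
  have -> : K (Complex p' q) - K (Complex p q) = Complex 0 1 * A.
    have -> : A = - (Complex 0 1 * (K (Complex p' q) - K (Complex p q))).
      by apply/eqP; rewrite -addr_eq0 hA.
    rewrite mulrN mulrA -expr2 sqr_i mulN1r opprK//.
  rewrite /D -mulrA -mulrBr cabsM cabs_i mul1r -cint_cst// -cintB//;
    [|by apply: cintegrableB => //; exact: ih|exact: cintegrable_cst].
  apply: ler_cabs_cint_itv => //.
    apply: cintegrableB => //; last exact: cintegrable_cst.
    by apply: cintegrableB => //; exact: ih.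
  move=> t /np ht.
  rewrite (_ : _ - _ - _ = (g (Complex t q) - g (Complex x y)) -
    (g (Complex t (q + s)) - g (Complex x (y + s)))); last by ring.
  apply: (le_trans (ler_cabsB _ _)); have := g1 _ _ ht; have := g2 _ _ ht.
  by move: (cabs _) (cabs _) => u v; clear; lra.
(* When the segment slides along its own line, only the short pieces at its two ends remain. *)
have ver p q q' : q <= q' -> near_z p q -> near_z p q' ->
    cabs (K (Complex p q') - K (Complex p q) - D * Complex 0 (q' - q)) <= e / 2 * (q' - q).
  move=> qq' npq npq'; have p0 := nx _ _ npq.
  have np t : q <= t <= q' -> near_z p t.
    by case: npq npq' => [hp hq] [_ hq'] ht; split=> //; exact: between ht hq hq'.
  have q1 : q <= q + s by rewrite lerDl ltW.
  have q2 : q' <= q' + s by rewrite lerDl ltW.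
  have q3 : q + s <= q' + s by rewrite lerD2r.
  have E : K (Complex p q') - K (Complex p q) =
      cint `[q + s, q' + s] (fun t => g (Complex p t)) - cint `[q, q'] (fun t => g (Complex p t)).
    have := cint_split q1 q3 (iv p q (q' + s) p0).
    rewrite (cint_split qq' q2 (iv p q (q' + s) p0)) /K /= => E.
    by apply/eqP; rewrite subr_eq addrAC eq_sym subr_eq addrC -E addrC.
  have -> : D * Complex 0 (q' - q) = g (Complex x (y + s)) * (q' + s - (q + s))%:C%C -
      g (Complex x y) * (q' - q)%:C%C.
    have -> : q' + s - (q + s) = q' - q by ring.
    have -> : Complex 0 (q' - q) = Complex 0 1 * (q' - q)%:C%C.
      by apply/eqP; rewrite eq_complex /=; apply/andP; split; apply/eqP; ring.
    have ii : Complex 0 1 * Complex 0 1 = -1 :> R[i] by rewrite -expr2 sqr_i.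
    rewrite /D; move: (Complex 0 1) ii => I ii.
    set A := g (Complex x y); set B := g (Complex x (y + s)); set t := (_%:C)%C.
    rewrite (_ : I * (A - B) * (I * t) = I * I * ((A - B) * t)); last by ring.
    by rewrite ii; ring.
  rewrite E -!cint_cst// (_ : forall a b c c' : R[i], a - b - (c - c') = (a - c) - (b - c'));
    last by move=> *; ring.
  rewrite -!cintB//; [|exact: iv|exact: cintegrable_cst|exact: iv|exact: cintegrable_cst].
  apply: (le_trans (ler_cabsB _ _)).
  have -> : e / 2 * (q' - q) = e / 4 * (q' + s - (q + s)) + e / 4 * (q' - q) by field.
  apply: lerD; apply: ler_cabs_cint_itv => //.
  - by apply: cintegrableB => //; [exact: iv|exact: cintegrable_cst].
  - move=> t ht; rewrite -(subrK s t); apply: g2; apply: np.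
    by clear -ht; lra.
  - by apply: cintegrableB => //; [exact: iv|exact: cintegrable_cst].
  - by move=> t ht; apply: g1; exact: np.
exists d => // -[x' y'] hw.
have hx : `|x' - x| < d by exact: (le_lt_trans (ler_Re_cabs (Complex x' y' - Complex x y)) hw).
have hy : `|y' - y| < d by exact: (le_lt_trans (ler_Im_cabs (Complex x' y' - Complex x y)) hw).
have dd (u : R) : `|u - u| < d by rewrite subrr normr0.
have hor' : cabs (K (Complex x' y') - K (Complex x y') - D * (x' - x)%:C%C) <= e / 2 * `|x' - x|.
  have [xx'|/ltW xx'] := leP x x'; first by rewrite ger0_norm ?subr_ge0//; exact: hor.
  have -> : K (Complex x' y') - K (Complex x y') - D * (x' - x)%:C%C =
      - (K (Complex x y') - K (Complex x' y') - D * (x - x')%:C%C).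
    by rewrite !rmorphB/=; move: (K _) (K _) (D) => u v t; ring.
  by rewrite cabsN ler0_norm ?subr_le0// opprB; exact: hor.
have ver' : cabs (K (Complex x y') - K (Complex x y) - D * Complex 0 (y' - y)) <=
    e / 2 * `|y' - y|.
  have [yy'|/ltW yy'] := leP y y'; first by rewrite ger0_norm ?subr_ge0//; exact: ver.
  have -> : K (Complex x y') - K (Complex x y) - D * Complex 0 (y' - y) =
      - (K (Complex x y) - K (Complex x y') - D * Complex 0 (y - y')).
    have -> : Complex 0 (y - y') = - Complex 0 (y' - y).
      by apply/eqP; rewrite eq_complex /= oppr0 opprB !eqxx.
    by move: (D) (K _) (K _) (Complex 0 _) => t u v r; ring.
  by rewrite cabsN ler0_norm ?subr_le0// opprB; exact: ver.
have -> : K (Complex x' y') - K (Complex x y) - D * (Complex x' y' - Complex x y) =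
    (K (Complex x' y') - K (Complex x y') - D * (x' - x)%:C%C) +
    (K (Complex x y') - K (Complex x y) - D * Complex 0 (y' - y)).
  have -> : Complex x' y' - Complex x y = (x' - x)%:C%C + Complex 0 (y' - y).
    by apply/eqP; rewrite eq_complex /= addr0 add0r !eqxx.
  ring.
apply: (le_trans (ler_cabsD _ _)); apply: (le_trans (lerD hor' ver')).
have := ler_Re_cabs (Complex x' y' - Complex x y).
have := ler_Im_cabs (Complex x' y' - Complex x y); rewrite /=.
move: `|x' - x| `|y' - y| (cabs _) => u v t h3 h4; rewrite -mulrDr -mulrA ler_wpM2l ?(ltW e0)//.
by clear -h3 h4; lra.
Qed.

(** The derivative of [K], of modulus [|g z - g (z + i s)|], is at most [M / Re z]. The summand [1]
    comes from choosing [s] with [|g (z + i s)| <= 1]: otherwise a vertical segment of length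
    [M + 1] would carry an integral larger than [M]. *)
Lemma H1_rhp_bounded g : H1_rhp g -> exists2 M, 0 <= M &
  forall z, 0 < complex.Re z -> cabs (g z) <= 1 + M / complex.Re z.
Proof.
move=> hg; have [M M0 hM] := H1_rhp_bound hg; exists M => // z z0.
have dg w : 0 < complex.Re w -> cdiff g w by exact: H1_rhp_cdiff.
have seg (x c d : R) : 0 < x -> \int[mu]_(y in `[c, d]) cabs (g (Complex x y)) <= M.
  move=> x0; apply: le_trans (hM x x0); apply: Rintegral_subset => //.
    by move=> y; exact: cabs_ge0.
  exact: H1_rhp_integrable.
have [s s0 hs] : exists2 s, 0 <= s & cabs (g (z + Complex 0 s)) <= 1.
  apply: contrapT => h.
  have := seg (complex.Re z) (complex.Im z) (complex.Im z + (M + 1)) z0.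
  apply/negP; rewrite -ltNge; apply: (@lt_le_trans _ _ (M + 1)); first by rewrite ltrDl.
  rewrite -[leLHS]mul1r (_ : 1 * _ = 1 * (complex.Im z + (M + 1) - complex.Im z)); last by ring.
  rewrite -Rintegral_cst_itv; last by rewrite lerDl addr_ge0.
  apply: le_Rintegral => //; first exact: integrable_cst_itv.
    by apply: integrableS (H1_rhp_integrable hg z0).
  move=> y; rewrite /= in_itv/= => /andP[hy _]; rewrite leNgt; apply/negP => hy'.
  apply: h; exists (y - complex.Im z); first by rewrite subr_ge0.
  rewrite (_ : z + _ = Complex (complex.Re z) y) ?ltW//.
  by case: (z) => p q; apply/eqP; rewrite eq_complex /= addr0 addrC subrK !eqxx.
move: s0; rewrite le_eqVlt => /predU1P[s0|s0].
  move: hs; rewrite -s0 (_ : Complex 0 0 = 0)// addr0 => /le_trans; apply.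
  by rewrite lerDl divr_ge0// ltW.
pose K w := cint `[complex.Im w, complex.Im w + s] (fun y => g (Complex (complex.Re w) y)).
have hK := @shift_primitive g s _ s0 _ dg.
have dK w : 0 < complex.Re w -> cdiff K w.
  by move=> w0; apply/cdiffP; eexists; exact: hK.
have KM w : 0 < complex.Re w -> cabs (K w) <= M.
  move=> w0; apply: le_trans (seg _ (complex.Im w) (complex.Im w + s) w0).
  apply: ler_cabs_cint => //.
    by apply/ccont_on_cintegrable/cdiff_ccont_vertical => y _; exact: dg.
  by apply: integrableS (H1_rhp_integrable hg w0).
have := derivative_bound z0 dK KM (hK z z0).
rewrite cabsM cabs_i mul1r -ler_pdivlMr// => h.
have := lerB_cabsB (g z) (g (z + Complex 0 s)).
by move: h hs; move: (M / _) (cabs _) (cabs _) (cabs _) => u1 u2 u3 u4; clear; lra.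
Qed.

End HardyBound.

(** * Uniqueness sets in the half-plane and Schwarz reflection *)

Section Identity.
Context {R : realType}.
Implicit Types (f g F : R[i] -> R[i]) (a z w zeta : R[i]).

Lemma Re_real_complex (t : R) : complex.Re t%:C%C = t.
Proof. by []. Qed.

(** The bound holds on whole half-planes [d <= Re z], not just on compact sets. This class contains
    [H^1] and is closed under the products and translations that the periodicity argument forms. *)
Definition rhp_locbounded F := (forall z, 0 < complex.Re z -> cdiff F z) /\
  forall d : R, 0 < d -> exists C, forall z, d <= complex.Re z -> cabs (F z) <= C.

Lemma H1_rhp_locbounded g : H1_rhp g -> rhp_locbounded g.
Proof.
move=> hg; split=> [z|d d0]; first exact: H1_rhp_cdiff.
have [M M0 hM] := H1_rhp_bounded hg; exists (1 + M / d) => z dz.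
have z0 : 0 < complex.Re z by exact: lt_le_trans dz.
by apply: (le_trans (hM z z0)); rewrite lerD2l ler_wpM2l// lef_pV2.
Qed.

Lemma rhp_locboundedM f g : rhp_locbounded f -> rhp_locbounded g ->
  rhp_locbounded (fun z => f z * g z).
Proof.
move=> [df bf] [dg bg]; split=> [z z0|d d0].
  by apply: cdiffM; [exact: df|exact: dg].
have [C hC] := bf d d0; have [C' hC'] := bg d d0; exists (C * C') => z dz.
by rewrite cabsM ler_pM ?cabs_ge0 ?hC ?hC'.
Qed.

Lemma rhp_locboundedB f g : rhp_locbounded f -> rhp_locbounded g ->
  rhp_locbounded (fun z => f z - g z).
Proof.
move=> [df bf] [dg bg]; split=> [z z0|d d0].
  by apply: cdiffB; [exact: df|exact: dg].
have [C hC] := bf d d0; have [C' hC'] := bg d d0; exists (C + C') => z dz.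
by apply: (le_trans (ler_cabsB _ _)); rewrite lerD ?hC ?hC'.
Qed.

Lemma rhp_locboundedZ c f : rhp_locbounded f -> rhp_locbounded (fun z => c * f z).
Proof.
apply: rhp_locboundedM; split=> [z z0|d d0]; first exact: cdiff_cst.
by exists (cabs c).
Qed.

Lemma rhp_locbounded_shift (t : R) f : 0 <= t -> rhp_locbounded f ->
  rhp_locbounded (fun z => f (z + t%:C%C)).
Proof.
move=> t0 [df bf]; split=> [z z0|d d0].
  by apply: cdiff_comp; [exact: cdiff_addr|apply: df; rewrite ReD ltr_wpDr].
have [C hC] := bf d d0; exists C => z dz; apply: hC.
by rewrite ReD ler_wpDr.
Qed.

(** Moving the boundary to [Re z = d], with [d] at most half of [m] and of [Re w], makes [F] bounded
    and keeps the zeros and [w] inside. *)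
Lemma rhp_uniqueness F (zs : nat -> R[i]) w (c m : R) : rhp_locbounded F ->
  injective zs -> (forall j, F (zs j) = 0) -> 0 < m -> (forall j, m <= complex.Re (zs j)) ->
  0 < c -> (forall j, c / j.+1%:R * (cabs w + cabs (zs j)) ^+ 2 <= complex.Re (zs j)) ->
  0 < complex.Re w -> F w = 0.
Proof.
move=> [dF bF] zinj hz m0 hm c0 hc w0.
have [|d d0 /=] := @exists_small R [:: m / 2; complex.Re w / 2].
  by rewrite /= !divr_gt0.
move=> /and3P[dm dw _]; have [C hC] := bF d d0.
pose k z := F (z + d%:C%C).
suff : k (w - d%:C%C) = 0 by rewrite /k subrK.
(* The shift costs at most a factor [4] in the squared distance and a factor [2] in the real part,
   whence [8]. *)
apply: (@blaschke_uniqueness _ k C (fun j => zs j - d%:C%C) _ (c / 8)).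
- move=> z z0; apply: cdiff_comp; first exact: cdiff_addr.
  by apply: dF; rewrite ReD addr_gt0.
- by move=> z z0; apply: hC; rewrite ReD /= lerDr ltW.
- by move=> i j /addIr; exact: zinj.
- move=> j; split; last by rewrite /k subrK.
  by rewrite ReB /=; have := hm j; clear -dm m0; lra.
- by rewrite divr_gt0.
- move=> j; rewrite ReB Re_real_complex.
  have mz : m <= cabs (zs j).
    by apply: (le_trans (hm j)); apply: le_trans (ler_Re_cabs _); exact: ler_norm.
  have h : cabs (w - d%:C%C + conjc (zs j - d%:C%C)) <= 2 * (cabs w + cabs (zs j)).
    apply: (le_trans (ler_cabsD _ _)); rewrite cabs_conj.
    have := ler_cabsB w d%:C%C; have := ler_cabsB (zs j) d%:C%C.
    rewrite cabs_real gtr0_norm//; have := cabs_ge0 w.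
    by move: mz dm; move: (cabs _) (cabs _) (cabs _) (cabs _) => u v u' v'; clear; lra.
  have h2 : cabs (w - d%:C%C + conjc (zs j - d%:C%C)) ^+ 2 <=
      4 * (cabs w + cabs (zs j)) ^+ 2.
    rewrite (_ : 4 * _ = (2 * (cabs w + cabs (zs j))) ^+ 2); last by ring.
    by rewrite ler_pXn2r ?nnegrE ?cabs_ge0 ?mulr_ge0 ?addr_ge0 ?cabs_ge0.
  apply: (@le_trans _ _ (c / 8 / j.+1%:R * (4 * (cabs w + cabs (zs j)) ^+ 2))).
    by rewrite ler_wpM2l// !divr_ge0// ltW.
  have halve (u v : R) : c / 8 * u * (4 * v) = c * u * v / 2 by field.
  have half_le (X u : R) : X <= u -> m <= u -> X / 2 <= u - d.
    by clear -dm; lra.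
  by rewrite halve; apply: half_le; [exact: hc|exact: hm].
- by rewrite ReB /=; clear -dw w0; lra.
Qed.

Lemma injective_invn (r : R) : 0 < r -> injective (fun j : nat => r / j.+2%:R).
Proof.
move=> r0 i j /(mulfI (lt0r_neq0 r0))/invr_inj/eqP.
by rewrite eqr_nat => /eqP[].
Qed.

(** The zeros [z + i r / (j + 2)] have constant real part and bounded modulus, so their Blaschke sum
    diverges; [j + 2] keeps the heights strictly below [r]. *)
Lemma rhp_identity F z w (r : R) : rhp_locbounded F -> 0 < complex.Re z -> 0 < r ->
  (forall t, 0 < t < r -> F (Complex (complex.Re z) (complex.Im z + t)) = 0) ->
  0 < complex.Re w -> F w = 0.
Proof.
move=> bF z0 r0 hF w0.
pose zs (j : nat) := Complex (complex.Re z) (complex.Im z + r / j.+2%:R).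
have rj (j : nat) : 0 < r / j.+2%:R < r.
  by rewrite divr_gt0//= ltr_pdivrMr// ltr_pMr// ltr1n.
pose A := cabs w + (complex.Re z + `|complex.Im z| + r) + 1.
have zsA j : cabs w + cabs (zs j) <= A.
  have := ler_cabs_ReIm (zs j); have := ler_normD (complex.Im z) (r / j.+2%:R).
  have /andP[h1 h2] := rj j; rewrite /A /= (gtr0_norm z0) (gtr0_norm h1).
  by move: h2; move: (_ / _) `|_| (cabs _) (cabs _) `|_| => u v u' v' u''; clear; lra.
have A1 : 1 <= A.
  by rewrite lerDr !addr_ge0 ?cabs_ge0// ltW.
apply: (@rhp_uniqueness F zs w (complex.Re z / A ^+ 2) (complex.Re z)) => //.
- by move=> i j [] /addrI; exact: injective_invn.
- by move=> j; apply: hF; exact: rj.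
- by rewrite divr_gt0// exprn_gt0//; exact: lt_le_trans A1.
- move=> j /=; have A0 : 0 < A by exact: lt_le_trans A1.
  rewrite mulrAC ler_pdivrMr// -mulrA ler_wpM2l ?(ltW z0)//.
  rewrite mulrC ler_pdivrMr ?exprn_gt0// (@le_trans _ _ (A ^+ 2))//.
    by rewrite ler_pXn2r ?nnegrE ?(ltW A0) ?addr_ge0 ?cabs_ge0 ?zsA.
  by rewrite ler_peMl ?exprn_ge0 ?(ltW A0)// ler1n.
Qed.

Lemma rhp_mul_eq0 f g : rhp_locbounded f -> rhp_locbounded g ->
  (forall z, 0 < complex.Re z -> f z * g z = 0) ->
  (exists2 z, 0 < complex.Re z & g z != 0) ->
  forall w, 0 < complex.Re w -> f w = 0.
Proof.
move=> bf bg fg0 [z z0 gz] w w0.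
have gz0 : 0 < cabs (g z) by rewrite cabs_gt0.
have [d d0 hd] := cdiff_continuous (bg.1 z z0) gz0.
apply: (rhp_identity bf z0 d0) => // t /andP[t0 td].
set v := Complex _ _; have gv : g v != 0.
  apply/eqP => gv; have := hd v; rewrite gv sub0r cabsN ltxx; apply/not_implyP.
  have -> : v - z = Complex 0 t.
    by rewrite /v; case: (z) => p q; apply/eqP; rewrite eq_complex /= subrr addrAC subrr add0r !eqxx.
  by rewrite /cabs /= expr0n add0r sqrtr_sqr gtr0_norm.
by apply/eqP; have /eqP := fg0 v z0; rewrite mulf_eq0 (negbTE gv) orbF.
Qed.

(** Real parts and moduli both grow linearly, so the Blaschke terms are of order [1 / j]. *)
Lemma rhp_arithmetic_progression F z : rhp_locbounded F -> 0 < complex.Re z ->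
  (forall j, F (z + (2 * j%:R)%:C%C) = 0) ->
  forall w, 0 < complex.Re w -> F w = 0.
Proof.
move=> bF z0 hF w w0.
pose m := Num.min (complex.Re z) 2; have m0 : 0 < m by rewrite lt_min z0 ltr0n.
pose A := cabs w + cabs z + 2; have A0 : 0 < A by rewrite ltr_wpDl ?addr_ge0 ?cabs_ge0.
have zm : m <= complex.Re z by rewrite ge_min lexx.
have m2 : m <= 2 by rewrite ge_min lexx orbT.
apply: (@rhp_uniqueness F (fun j => z + (2 * j%:R)%:C%C) w (m / A ^+ 2) m) => //.
- move=> i j /addrI[] /mulfI h; apply/eqP; rewrite -(eqr_nat R); apply/eqP/h.
  by rewrite pnatr_eq0.
- by move=> j; rewrite ReD /= ler_wpDr// mulr_ge0.
- by rewrite divr_gt0// exprn_gt0.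
- move=> j; rewrite ReD Re_real_complex.
  have j0 : 0 <= j%:R :> R by [].
  have h1 : cabs w + cabs (z + (2 * j%:R)%:C%C) <= A * j.+1%:R.
    have step (u v t n : R) : t <= v + 2 * n -> 0 <= (u + v) * n ->
        u + t <= (u + v + 2) * (n + 1) by clear; lra.
    rewrite /A -[j.+1%:R]natr1; apply: step; last by rewrite mulr_ge0 ?addr_ge0 ?cabs_ge0.
    by apply: (le_trans (ler_cabsD _ _)); rewrite cabs_real ger0_norm ?mulr_ge0.
  apply: (@le_trans _ _ (m * j.+1%:R)); last first.
    have step (u n : R) : m <= u -> 0 <= (2 - m) * n -> m * (n + 1) <= u + 2 * n.
      by clear; lra.
    by rewrite -[j.+1%:R]natr1; apply: step => //; rewrite mulr_ge0// subr_ge0.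
  have -> : m * j.+1%:R = m / A ^+ 2 / j.+1%:R * (A * j.+1%:R) ^+ 2.
    by field; rewrite !gt_eqF// ltr_wpDl.
  rewrite ler_wpM2l//; first by rewrite !divr_ge0 ?exprn_ge0// ltW.
  by rewrite ler_pXn2r ?nnegrE ?h1 ?(mulr_ge0 (ltW A0)) ?(addr_ge0 (cabs_ge0 _) (cabs_ge0 _)).
Qed.

(* The circle [|zeta| = 1] is mapped to the vertical diameter of the disk of centre
   [s + i y] and radius [r] by [zeta |-> s + i y + r (zeta - 1) / (zeta + 1)]. *)
Lemma reflection_eq f g (s : R) : rhp_locbounded f -> rhp_locbounded g -> 0 < s ->
  (forall y, cabs (f (Complex s y)) = cabs (g (Complex s y))) ->
  forall z, 0 < complex.Re z -> complex.Re z < 2 * s ->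
    f z * conjc (f ((2 * s)%:C%C - conjc z)) = g z * conjc (g ((2 * s)%:C%C - conjc z)).
Proof.
move=> [df bf] [dg bg] s0 hfg [x y] /= x0 xs; set z := Complex x y.
pose F u := f u * conjc (f ((2 * s)%:C%C - conjc u)) - g u * conjc (g ((2 * s)%:C%C - conjc u)).
apply/eqP; rewrite -subr_eq0 -/(F z); apply/eqP.
pose r := (`|x - s| + s) / 2.
(* The disk of radius [r] about [s + i y] contains [z], and its closure lies in the strip. *)
have [xr rs] : `|x - s| < r /\ r < s.
  have : `|x - s| < s by rewrite ltr_norml; clear -x0 xs; lra.
  by rewrite /r; move: `|_| => u; clear; split; lra.
have r0 : 0 < r by apply: le_lt_trans xr.
(* [F] is controlled only on the strip, whereas the uniqueness theorem needs a half-plane; this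
   Cayley transform carries the half-plane into the disk. *)
pose phi zeta := Complex s y + r%:C%C * ((zeta - 1) / (zeta + 1)).
have p1 zeta : 0 < complex.Re zeta -> zeta + 1 != 0.
  by move=> h; apply: rhp_addr1_neq0; exact: ltW.
have cay zeta : 0 < complex.Re zeta -> cabs ((zeta - 1) / (zeta + 1)) <= 1.
  move=> h; rewrite cabsM cabsV ler_pdivrMr ?cabs_gt0 ?p1// mul1r.
  rewrite -(ler_pXn2r (n := 2)) ?nnegrE ?cabs_ge0// !sqr_cabs.
  by case: zeta h => p q /= h; rewrite subr0 addr0; clear -h; lra.
have phir zeta : 0 < complex.Re zeta -> `|complex.Re (phi zeta) - s| <= r.
  move=> h; have -> : complex.Re (phi zeta) - s = complex.Re (phi zeta - Complex s y).
    by rewrite ReB.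
  apply: (le_trans (ler_Re_cabs _)); rewrite /phi addrAC subrr add0r cabsM cabs_real.
  by rewrite gtr0_norm// ler_piMr ?cay// ltW.
have d0 : 0 < s - r by rewrite subr_gt0.
have phid zeta : 0 < complex.Re zeta -> s - r <= complex.Re (phi zeta) /\
    s - r <= complex.Re ((2 * s)%:C%C - conjc (phi zeta)).
  move=> /phir; rewrite ReB Re_conjc /= ler_norml.
  by move: (complex.Re _) => u; clear; split; lra.
have [Cf hf] := bf _ d0; have [Cg hg] := bg _ d0.
pose ti (j : nat) : R := 1 / j.+2%:R.
(* Rational parametrisation of the unit circle, chosen so that [phi (zs j) = s + i (y + r * ti j)].
   There the mirror image is the point itself, and [F] is the difference of the squared moduli. *)
pose zs j := Complex ((1 - ti j ^+ 2) / (1 + ti j ^+ 2)) (2 * ti j / (1 + ti j ^+ 2)).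
have tj j : 0 < ti j <= 2^-1.
  by rewrite divr_gt0//= /ti mul1r lef_pV2 ?posrE// ler_nat.
have den j : 0 < 1 + ti j ^+ 2 by rewrite ltr_wpDr// sqr_ge0.
have sqt j : ti j ^+ 2 <= 4^-1.
  have /andP[h1 h2] := tj j; have -> : 4^-1 = 2^-1 ^+ 2 :> R by field.
  by rewrite ler_pXn2r ?nnegrE ?(ltW h1).
have zs0 j : 2^-1 <= complex.Re (zs j).
  by rewrite /= ler_pdivlMr ?den//; have := sqt j; move: (_ ^+ 2) => u; clear; lra.
have zspos j : 0 < complex.Re (zs j) by apply: lt_le_trans (zs0 j); rewrite invr_gt0.
have cayz j : (zs j - 1) / (zs j + 1) = Complex 0 (ti j).
  have h := p1 _ (zspos j); apply: (mulIf h); rewrite divfK//.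
  have hd := lt0r_neq0 (den j).
  by apply/eqP; rewrite eq_complex /=; apply/andP; split; apply/eqP; field.
(* The solution of [(w - 1) / (w + 1) = (x - s) / r], that is, of [phi w = z]. *)
pose w := ((1 + (x - s) / r) / (1 - (x - s) / r))%:C%C.
have u1 : 0 < 1 - (x - s) / r /\ 0 < 1 + (x - s) / r.
  have : `|(x - s) / r| < 1 by rewrite normrM normfV (gtr0_norm r0) ltr_pdivrMr// mul1r.
  by rewrite ltr_norml; move: (_ / r) => u; clear; split; lra.
have w0 : 0 < complex.Re w by rewrite /= divr_gt0//; case: u1.
have phiw : phi w = z.
  have [v1 v2] := u1.
  rewrite /phi (_ : (w - 1) / (w + 1) = ((x - s) / r)%:C%C).
    rewrite -rmorphM/= mulrC divfK ?gt_eqF//; apply/eqP; rewrite eq_complex /= addr0.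
    by rewrite addrC subrK !eqxx.
  have h := p1 _ w0; apply: (mulIf h); rewrite divfK//.
  have hd := lt0r_neq0 v1.
  rewrite /w; move: hd; move: (_ / r) => u hd; apply/eqP; rewrite eq_complex /=.
  by apply/andP; split; apply/eqP; [field|ring].
rewrite -phiw.
apply: (@blaschke_uniqueness _ (fun zeta => F (phi zeta)) (Cf * Cf + Cg * Cg) zs w
   (2^-1 / (cabs w + 1) ^+ 2)).
- move=> zeta h; have [h1 h2] := phid _ h.
  have h1' := lt_le_trans d0 h1; have h2' := lt_le_trans d0 h2.
  apply: (cdiff_comp (F := F) (G := phi)).
    apply: cdiffD; first exact: cdiff_cst.
    apply: cdiffM; first exact: cdiff_cst.
    by apply: cdiff_div; [exact: p1|exact: cdiff_subr|exact: cdiff_addr].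
  apply: cdiffB; apply: cdiffM.
  + exact: df.
  + by apply: cdiff_reflect; exact: df.
  + exact: dg.
  + by apply: cdiff_reflect; exact: dg.
- move=> zeta h; have [h1 h2] := phid _ h; rewrite /F.
  apply: (le_trans (ler_cabsB _ _)); rewrite !cabsM !cabs_conj.
  by apply: lerD; apply: ler_pM; rewrite ?cabs_ge0 ?hf ?hg.
- move=> i j E; have := cayz i; rewrite E cayz => -[].
  by move=> /(@injective_invn 1 ltr01).
- move=> j; split; first exact: zspos.
  rewrite /phi cayz; set v := Complex s y + _.
  have -> : v = Complex s (y + r * ti j).
    by apply/eqP; rewrite eq_complex /=; apply/andP; split; apply/eqP; ring.
  set q := y + _; have E : (2 * s)%:C%C - conjc (Complex s q) = Complex s q.
    by apply/eqP; rewrite eq_complex /=; apply/andP; split; apply/eqP; ring.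
  by rewrite /F E !mulc_conj hfg subrr.
- by rewrite divr_gt0// exprn_gt0// ltr_wpDl// cabs_ge0.
- move=> j; apply: le_trans (zs0 j).
  have B0 : 0 < (cabs w + 1) ^+ 2 by rewrite exprn_gt0// ltr_wpDl// cabs_ge0.
  have zs1 : cabs (zs j) = 1.
    apply/eqP; rewrite -(eqrXn2 (n := 2)) ?cabs_ge0// sqr_cabs /= expr1n; apply/eqP.
    by have hd := lt0r_neq0 (den j); field.
  have : cabs (w + conjc (zs j)) ^+ 2 <= (cabs w + 1) ^+ 2.
    rewrite ler_pXn2r ?nnegrE ?cabs_ge0 ?addr_ge0 ?cabs_ge0//.
    by apply: (le_trans (ler_cabsD _ _)); rewrite cabs_conj zs1.
  move=> h; apply: (le_trans (ler_wpM2l _ h)); first by rewrite !divr_ge0// ltW.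
  by rewrite mulrAC divfK ?gt_eqF// ler_pdivrMr// ler_peMr ?invr_ge0// ler1n.
- exact: w0.
Qed.

End Identity.

(** * Cauchy transforms and Poisson majorants *)

Section PoissonMajorant.
Context {R : realType}.
Notation mu := (@lebesgue_measure R).
Implicit Types (u : R -> R) (c h : R -> R[i]) (g : R[i] -> R[i]) (z w : R[i]).

Lemma ccont_on_continuous c : (forall a b, ccont_on a b c) ->
  continuous (fun y => complex.Re (c y)) /\ continuous (fun y => complex.Im (c y)).
Proof.
move=> cc; split=> y; apply/cvgrPdist_lt => e e0.
- have [|d d0 hd] := cc (y - 1) (y + 1) y _ e e0; first by clear; lra.
  apply/nbhs_ballP; exists (Num.min d 1); first by rewrite /= lt_min d0 ltr01.
  move=> y' /=; rewrite lt_min distrC => /andP[yd]; rewrite ltr_norml => /andP[y1 y2].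
  rewrite distrC -ReB; apply: le_lt_trans (ler_Re_cabs _) _.
  by apply: hd => //; clear -y1 y2; lra.
- have [|d d0 hd] := cc (y - 1) (y + 1) y _ e e0; first by clear; lra.
  apply/nbhs_ballP; exists (Num.min d 1); first by rewrite /= lt_min d0 ltr01.
  move=> y' /=; rewrite lt_min distrC => /andP[yd]; rewrite ltr_norml => /andP[y1 y2].
  rewrite distrC -ImB; apply: le_lt_trans (ler_Im_cabs _) _.
  by apply: hd => //; clear -y1 y2; lra.
Qed.

Lemma integrable_mul_bounded u (v : R -> R) (B : R) : continuous u -> continuous v ->
  (forall y, 0 <= u y) -> mu.-integrable setT (EFin \o u) -> (forall y, `|v y| <= B) ->
  mu.-integrable setT (EFin \o (fun y => u y * v y)).
Proof.
move=> cu cv u0 iu vB.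
have iBu : mu.-integrable setT (EFin \o (fun y => B * u y)).
  exact: (integrableZl measurableT B iu).
have muv : measurable_fun setT (fun y : measurableTypeR R => u y * v y).
  by apply: measurable_funM; exact: continuous_measurable_fun.
apply: (le_integrable measurableT) iBu; first exact: (measurableT_comp _ muv).
move=> y _ /=; rewrite lee_fin !normrM (ger0_norm (u0 y)) mulrC ler_wpM2r//.
by apply: (le_trans (vB y)); exact: ler_norm.
Qed.

Lemma cintegrable_mul_bounded u c (B : R) : continuous u -> (forall y, 0 <= u y) ->
  mu.-integrable setT (EFin \o u) -> (forall a b, ccont_on a b c) ->
  (forall y, cabs (c y) <= B) -> cintegrable setT (fun y => (u y)%:C%C * c y).
Proof.
move=> cu u0 iu cc cB; have [cRe cIm] := ccont_on_continuous cc.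
apply: cintegrable_ReIm.
  have := @integrable_mul_bounded u _ B cu cRe u0 iu.
  move=> /(_ (fun y => le_trans (ler_Re_cabs _) (cB y))).
  by apply: eq_integrable => // y _ /=; case: (c y) => p q /=; rewrite mul0r subr0.
have := @integrable_mul_bounded u _ B cu cIm u0 iu.
move=> /(_ (fun y => le_trans (ler_Im_cabs _) (cB y))).
by apply: eq_integrable => // y _ /=; case: (c y) => p q /=; rewrite mul0r addr0.
Qed.

(** For [u >= 0] this is holomorphic to the right of [Re z = x0], with real part [pi] times the
    Poisson integral of [u]. *)
Definition cauchy_transform u (x0 : R) z : R[i] :=
  cint setT (fun y => (u y)%:C%C * (z - Complex x0 y)^-1).

Section CauchyTransform.
Variables (u : R -> R) (x0 : R).
Hypothesis (cu : continuous u) (u0 : forall y, 0 <= u y).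
Hypothesis (iu : mu.-integrable setT (EFin \o u)).

Lemma line_dist z y : complex.Re z - x0 <= cabs (z - Complex x0 y).
Proof.
by apply: le_trans (ler_Re_cabs _); apply: le_trans (ler_norm _); rewrite ReB.
Qed.

Lemma line_neq0 z y : x0 < complex.Re z -> z - Complex x0 y != 0.
Proof.
by move=> z0; rewrite -cabs_gt0; apply: lt_le_trans (line_dist _ _); rewrite subr_gt0.
Qed.

Lemma line_inv_ccont z (a b : R) : x0 < complex.Re z ->
  ccont_on a b (fun y => (z - Complex x0 y)^-1).
Proof.
move=> z0; apply: (@cdiff_ccont_vertical R (fun v => (z - v)^-1)) => y _.
apply: cdiffV; first exact: line_neq0.
by apply: cdiffB; [exact: cdiff_cst|exact: cdiff_id].
Qed.

Lemma line_inv_le z y (d : R) : 0 < d -> d <= complex.Re z - x0 ->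
  cabs (z - Complex x0 y)^-1 <= d^-1.
Proof.
move=> d0 dz; have h := le_trans dz (line_dist z y).
by rewrite cabsV lef_pV2 ?posrE// (lt_le_trans d0 h).
Qed.

Lemma cauchy_transform_cintegrable z : x0 < complex.Re z ->
  cintegrable setT (fun y => (u y)%:C%C * (z - Complex x0 y)^-1).
Proof.
move=> z0; apply: (@cintegrable_mul_bounded _ _ (complex.Re z - x0)^-1) => //.
  by move=> a b; exact: line_inv_ccont.
by move=> y; apply: line_inv_le => //; rewrite subr_gt0.
Qed.

Lemma cauchy_transform_bound z : x0 < complex.Re z ->
  cabs (cauchy_transform u x0 z) <= (complex.Re z - x0)^-1 * \int[mu]_y u y.
Proof.
move=> z0; rewrite -RintegralZl//; apply: ler_cabs_cint => //.
- exact: cauchy_transform_cintegrable.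
- exact: (integrableZl measurableT _ iu).
move=> y _; rewrite cabsM cabs_real ger0_norm// mulrC ler_wpM2r//.
by apply: line_inv_le => //; rewrite subr_gt0.
Qed.

(** The remainder of the first-order expansion of the Cauchy kernel is exactly
    [(w - z) ^ 2 / ((z - v) ^ 2 (w - v))], so no interchange of limits is involved. *)
Lemma cauchy_transform_cdiff z : x0 < complex.Re z -> cdiff (cauchy_transform u x0) z.
Proof.
move=> z0; pose a := complex.Re z - x0; have a0 : 0 < a by rewrite subr_gt0.
have i2 : cintegrable setT (fun y => (u y)%:C%C * ((z - Complex x0 y) ^+ 2)^-1).
  apply: (@cintegrable_mul_bounded _ _ (a^-1 ^+ 2)) => //.
    move=> p q; apply: (@cdiff_ccont_vertical R (fun v => ((z - v) ^+ 2)^-1)) => y _.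
    apply: cdiffV; first by rewrite expf_neq0// line_neq0.
    by apply/cdiffX/cdiffB; [exact: cdiff_cst|exact: cdiff_id].
  move=> y; rewrite cabsV cabsX -exprVn -cabsV.
  by rewrite ler_pXn2r ?nnegrE ?cabs_ge0 ?invr_ge0 ?(ltW a0)//; exact: line_inv_le.
set D := cint setT (fun y => (u y)%:C%C * ((z - Complex x0 y) ^+ 2)^-1) in i2 *.
apply/cdiffP; exists (- D) => e e0.
pose I := \int[mu]_y u y; have I0 : 0 <= I by apply: Rintegral_ge0 => y _.
(* Bounds the remainder kernel: [z] is at distance at least [a] from the line, and [w] at least
   [a / 2]. *)
pose A := a^-1 ^+ 2 * (a / 2)^-1; have A0 : 0 < A.
  by rewrite mulr_gt0 ?exprn_gt0 ?invr_gt0 ?divr_gt0.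
have [|d d0 /=] := @exists_small R [:: a / 2; e / (A * I + 1)].
  by rewrite /= !divr_gt0// ltr_wpDl// mulr_ge0// ltW.
move=> /and3P[da de _]; exists d => // w wd.
have aw : a / 2 <= complex.Re w - x0.
  have := ler_Re_cabs (w - z); rewrite ReB ler_norml => /andP[h _].
  by rewrite /a in da *; clear -h da wd; lra.
have w0 : x0 < complex.Re w by rewrite -subr_gt0; apply: lt_le_trans aw; rewrite divr_gt0.
have E : cauchy_transform u x0 w - cauchy_transform u x0 z - - D * (w - z) =
    cint setT (fun y => (u y)%:C%C * (w - Complex x0 y)^-1 - (u y)%:C%C * (z - Complex x0 y)^-1 -
      (z - w) * ((u y)%:C%C * ((z - Complex x0 y) ^+ 2)^-1)).
  rewrite cintB//; first last.
  - exact: cintegrableZ.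
  - by apply: cintegrableB => //; exact: cauchy_transform_cintegrable.
  rewrite cintB//; [|exact: cauchy_transform_cintegrable|exact: cauchy_transform_cintegrable].
  rewrite cintZ// -/D /cauchy_transform; ring.
rewrite E; apply: (@le_trans _ _ (A * I * cabs (w - z) ^+ 2)).
  rewrite mulrAC /I -RintegralZl//; apply: ler_cabs_cint => //.
  - apply: cintegrableB => //; last exact: cintegrableZ.
    by apply: cintegrableB => //; exact: cauchy_transform_cintegrable.
  - exact: (integrableZl measurableT _ iu).
  move=> y _; have zy := line_neq0 y z0; have wy := line_neq0 y w0.
  rewrite (_ : _ - _ - _ = (u y)%:C%C * ((w - z) ^+ 2 * ((z - Complex x0 y)^-1 ^+ 2 *
     (w - Complex x0 y)^-1))); last first.
    by field; rewrite zy wy.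
  rewrite cabsM cabs_real ger0_norm// mulrC ler_wpM2r// cabsM cabsX mulrC.
  rewrite ler_wpM2r ?sqr_ge0// cabsM cabsX ler_pM ?sqr_ge0 ?cabs_ge0//.
    by rewrite ler_pXn2r ?nnegrE ?cabs_ge0 ?invr_ge0 ?(ltW a0)//; exact: line_inv_le.
  by apply: line_inv_le => //; rewrite divr_gt0.
rewrite expr2 mulrA ler_wpM2r ?cabs_ge0//.
apply: (@le_trans _ _ ((A * I + 1) * d)).
  apply: ler_pM; rewrite ?cabs_ge0 ?(ltW wd)//; first by rewrite mulr_ge0// ltW.
  by rewrite lerDl.
by rewrite mulrC -ler_pdivlMr// ltr_wpDl// mulr_ge0// ltW.
Qed.

Lemma Re_cauchy_transform (a b : R) : 0 < a ->
  complex.Re (cauchy_transform u x0 (Complex (x0 + a) b)) =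
  a * \int[mu]_y (poisson a b y * u y) /\
  mu.-integrable setT (EFin \o (fun y => poisson a b y * u y)).
Proof.
move=> a0.
have ip : mu.-integrable setT (EFin \o (fun y => poisson a b y * u y)).
  have cp : continuous (poisson a b).
    have cc p q := @poisson_mul_ccont_on R (fun=> 1) 0 1 a b p q ltr01 a0
      (fun z _ => @cdiff_cst R 1 z).
    have [+ _] := ccont_on_continuous cc.
    by under [X in continuous X -> _]eq_fun do rewrite mulr1.
  have := @integrable_mul_bounded u _ (a ^+ 2)^-1 cu cp u0 iu.
  move=> h; have {h}[|] := (h _, I).
    by move=> y; rewrite ger0_norm ?poisson_ge0// poisson_le.
  by move=> h _; apply: eq_integrable h => // y _ /=; rewrite mulrC.
split=> //; rewrite Re_cint -RintegralZl//; apply: eq_Rintegral => y _.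
rewrite (_ : Complex (x0 + a) b - Complex x0 y = Complex a (b - y)); last first.
  by apply/eqP; rewrite eq_complex /= addrAC subrr add0r !eqxx.
rewrite /poisson (_ : y - b = - (b - y)); last by ring.
by rewrite sqrrN /= mul0r subr0; ring.
Qed.

End CauchyTransform.

(** The limit of large [L] in [poisson_ineq]. Bounding the mass below by [1 / a] makes the majorant
    [pi] times the sharp one, but still the real part of a holomorphic function. *)
Lemma H1_poisson_ineq g (x0 a b : R) : H1_rhp g -> 0 < x0 -> 0 < a ->
  cabs (g (Complex (x0 + a) b)) <=
  complex.Re (cauchy_transform (fun y => cabs (g (Complex x0 y))) x0 (Complex (x0 + a) b)).
Proof.
move=> hg x00 a0.
have cu := H1_rhp_line_continuous hg x00.
have iu := H1_rhp_integrable hg x00.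
have u0 y : 0 <= cabs (g (Complex x0 y)) by exact: cabs_ge0.
have [-> ip] := Re_cauchy_transform x0 cu u0 iu b a0.
set J := \int[mu]_y _.
have s0 : 0 < x0 / 2 by rewrite divr_gt0.
have [dg bg] := H1_rhp_locbounded hg; have [C hC] := bg _ s0.
have C0 : 0 <= C.
  by apply: le_trans (hC (Complex x0 0) _); [exact: cabs_ge0|rewrite /=; clear -x00; lra].
apply/ler_addgt0Pr => e e0.
pose L := 2 * a + 12 * C * a / e.
have aL : 2 * a <= L by rewrite lerDl divr_ge0 ?(ltW e0)// !mulr_ge0// ltW.
have L0 : 0 < L by apply: lt_le_trans aL; rewrite mulr_gt0.
have sx : x0 / 2 < x0 by clear -x00; lra.
have := @poisson_ineq R g (x0 / 2) C x0 a b L sx a0 aL.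
have hd z : x0 / 2 < complex.Re z -> cdiff g z by move=> h; apply: dg; exact: lt_trans h.
have hB z : x0 / 2 < complex.Re z -> cabs (g z) <= C by move=> h; apply: hC; exact: ltW.
move=> /(_ hd hB) h.
have hJ : \int[mu]_(y in `[b - L, b + L]) (poisson a b y * cabs (g (Complex x0 y))) <= J.
  by apply: Rintegral_subset => // y; rewrite mulr_ge0 ?poisson_ge0.
have hm : a^-1 <= \int[mu]_(y in `[b - L, b + L]) poisson a b y.
  by apply: poisson_mass => //; clear -aL a0; lra.
have {h hJ} h : cabs (g (Complex (x0 + a) b)) * a^-1 <= J + 12 * C / L.
  apply: le_trans (lerD hJ (lexx _)); apply: le_trans h.
  by rewrite ler_wpM2l ?cabs_ge0.
have hL : a * (12 * C / L) <= e.
  rewrite mulrA ler_pdivrMr// /L mulrDr mulrC.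
  have -> : e * (12 * C * a / e) = 12 * C * a by field; rewrite gt_eqF.
  by rewrite lerDr mulr_ge0 ?(ltW e0)// mulr_ge0// ltW.
move: h; rewrite ler_pdivrMr// mulrDl (mulrC J) (mulrC (_ / L)) => h.
by apply: (le_trans h); rewrite lerD2l.
Qed.

End PoissonMajorant.

(** * Uniqueness from vanishing boundary values on an interval *)

Section BoundaryUniqueness.
Context {R : realType}.
Notation mu := (@lebesgue_measure R).
Implicit Types (g k : R[i] -> R[i]) (z w : R[i]).

(** An excess [v] over the bound [1] costs only its integral: the kernel is at most [1 / a ^ 2] and
    its mass at least [1 / a]. *)
Lemma poisson_le_one_add k (s0 C x0 : R) w (v : R -> R) : s0 < x0 -> x0 < complex.Re w ->
  (forall z, s0 < complex.Re z -> cdiff k z) ->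
  (forall z, s0 < complex.Re z -> cabs (k z) <= C) ->
  (forall y, 0 <= v y) -> mu.-integrable setT (EFin \o v) ->
  (forall y, cabs (k (Complex x0 y)) <= 1 + v y) ->
  cabs (k w) <= 1 + (complex.Re w - x0)^-1 * \int[mu]_y v y.
Proof.
move=> sx0 xw dk kC v0 iv kv.
pose a := complex.Re w - x0; pose b := complex.Im w.
have a0 : 0 < a by rewrite subr_gt0.
have wE : w = Complex (x0 + a) b.
  by case: w @a @b {xw a0} => p q /=; rewrite addrC subrK.
have C0 : 0 <= C by apply: le_trans (kC w (lt_trans sx0 xw)); exact: cabs_ge0.
apply/ler_addgt0Pr => e e0; rewrite -/a.
pose L := 2 * a + 12 * C * a / e.
have aL : 2 * a <= L by rewrite lerDl divr_ge0 ?(ltW e0)// !mulr_ge0// ltW.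
have L0 : 0 < L by apply: lt_le_trans aL; rewrite mulr_gt0.
have := poisson_ineq b sx0 a0 aL dk kC; rewrite -wE.
set I := (X in _ * X <= _ -> _) => h.
have I0 : a^-1 <= I.
  by apply: poisson_mass => //; apply: le_trans aL; clear -a0; lra.
set V := \int[mu]_y v y.
have iD : mu.-integrable `[b - L, b + L] (EFin \o (fun y => (a ^+ 2)^-1 * v y)).
  by apply: (integrableZl _ (a ^+ 2)^-1 (integrableS _ _ _ iv)).
have ip := poisson_integrable b (b - L) (b + L) a0.
have hB : \int[mu]_(y in `[b - L, b + L]) (poisson a b y * cabs (k (Complex x0 y))) <=
    I + (a ^+ 2)^-1 * V.
  apply: (@le_trans _ _ (I + \int[mu]_(y in `[b - L, b + L]) ((a ^+ 2)^-1 * v y))).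
    rewrite /I -RintegralD//; apply: le_Rintegral => //.
    - exact: (poisson_mul_integrable _ _ _ sx0 a0 dk).
    - exact: (integrableD _ ip iD).
    move=> y _; apply: (le_trans (ler_wpM2l (poisson_ge0 a b y) (kv y))).
    by rewrite mulrDr mulr1 lerD2l ler_wpM2r// poisson_le.
  rewrite lerD2l RintegralZl//; last by apply: integrableS iv.
  by rewrite ler_wpM2l ?invr_ge0 ?sqr_ge0//; exact: Rintegral_subset.
have {hB}h : (cabs (k w) - 1) * I <= (a ^+ 2)^-1 * V + 12 * C / L.
  rewrite mulrBl mul1r lerBlDl addrA; apply: (le_trans h).
  by rewrite lerD2r.
have V0 : 0 <= V by exact: Rintegral_ge0.
(* Replacing the mass by its lower bound is legitimate only when [cabs (k w) - 1] is nonnegative. *)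
have [k1|k1] := leP (cabs (k w)) 1.
  by apply: (le_trans k1); rewrite -addrA lerDl addr_ge0 ?(ltW e0)// mulr_ge0// invr_ge0 ltW.
have {h}: (cabs (k w) - 1) * a^-1 <= (a ^+ 2)^-1 * V + 12 * C / L.
  by apply: le_trans h; rewrite ler_wpM2l// subr_ge0 ltW.
rewrite ler_pdivrMr// mulrDl => h.
have hL : 12 * C / L * a <= e.
  rewrite mulrAC ler_pdivrMr//.
  have -> : e * L = e * (2 * a) + 12 * C * a by rewrite /L; field; rewrite gt_eqF.
  by rewrite lerDr mulr_ge0 ?(ltW e0)// mulr_ge0// ltW.
have E : (a ^+ 2)^-1 * V * a = a^-1 * V by field; rewrite gt_eqF.
rewrite E in h; rewrite -addrA -lerBlDl; apply: (le_trans h).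
by rewrite lerD2l.
Qed.

(* [c / (z - i y0 + 1)] has modulus at most [1] on the imaginary axis outside
   [y0 - eta, y0 + eta], but is larger than [1] at points close to [i y0]. *)
Lemma H1_interval_estimate g (x0 y0 eta M : R) w n : H1_rhp g -> 0 < x0 -> 0 < eta ->
  2 * x0 < complex.Re w -> \int[mu]_y cabs (g (Complex x0 y)) <= M ->
  cabs (g w) * (Num.sqrt (1 + eta ^+ 2) / cabs (w - Complex 0 y0 + 1)) ^+ n <=
  (1 + M / (complex.Re w - x0)) * (1 + Num.sqrt (1 + eta ^+ 2) ^+ n *
    ((complex.Re w - 2 * x0)^-1 *
     \int[mu]_(y in `[y0 - eta, y0 + eta]) Num.min 1 (cabs (g (Complex (2 * x0) y))))).
Proof.
move=> hg x00 eta0 xw hM.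
set c := Num.sqrt _; set D := `[y0 - eta, y0 + eta].
pose h y := Num.min 1 (cabs (g (Complex (2 * x0) y))).
have x02 : x0 < 2 * x0 by clear -x00; lra.
have c0 : 0 < c by rewrite sqrtr_gt0 ltr_wpDr ?sqr_ge0.
have c2 : c ^+ 2 = 1 + eta ^+ 2 by rewrite sqr_sqrtr// addr_ge0// sqr_ge0.
have c1 : 1 <= c by rewrite -sqrtr1 ler_sqrt ?addr_ge0 ?sqr_ge0// lerDl sqr_ge0.
pose u y := cabs (g (Complex x0 y)).
have cu := H1_rhp_line_continuous hg x00.
have iu := H1_rhp_integrable hg x00.
have u0 y : 0 <= u y by exact: cabs_ge0.
(* [V] lives to the right of [Re z = x0], so the comparison is made on the line [Re z = 2 * x0]. *)
pose V := cauchy_transform u x0.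
have ReV z : x0 < complex.Re z -> cabs (g z) <= complex.Re (V z).
  move=> xz; have := @H1_poisson_ineq R g x0 (complex.Re z - x0) (complex.Im z) hg x00.
  by rewrite subr_gt0 addrC subrK => /(_ xz); case: (z).
have V1 z : x0 < complex.Re z -> 1 + cabs (g z) <= cabs (1 + V z).
  move=> xz; apply: le_trans (ler_Re_cabs _); apply: le_trans (ler_norm _).
  by rewrite ReD lerD2l ReV.
have Vgt0 z : x0 < complex.Re z -> 0 < cabs (1 + V z).
  by move=> xz; apply: lt_le_trans (V1 z xz); rewrite ltr_pwDl// cabs_ge0.
have pos z : x0 < complex.Re z -> 0 < complex.Re z by exact: lt_trans.
have dist1 z : 0 < complex.Re z -> 1 + (complex.Im z - y0) ^+ 2 <= cabs (z - Complex 0 y0 + 1) ^+ 2.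
  move=> z0; rewrite sqr_cabs ReD ReB ImD ImB /= subr0 addr0 lerD2r.
  by rewrite -[leLHS]addr0 sqrrD1; have := sqr_ge0 (complex.Re z); clear -z0; lra.
have dist z : 0 < complex.Re z -> 1 <= cabs (z - Complex 0 y0 + 1).
  move=> z0; rewrite -(ler_pXn2r (n := 2)) ?nnegrE ?cabs_ge0// expr1n.
  by apply: le_trans (dist1 z z0); rewrite lerDl sqr_ge0.
have dist0 z : 0 < complex.Re z -> 0 < cabs (z - Complex 0 y0 + 1).
  by move=> /dist; exact: lt_le_trans.
pose Q z := c%:C%C / (z - Complex 0 y0 + 1).
have QE z : cabs (Q z) = c / cabs (z - Complex 0 y0 + 1).
  by rewrite cabsM cabsV cabs_real gtr0_norm.
have Qc z : 0 < complex.Re z -> cabs (Q z) <= c.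
  by move=> z0; rewrite QE ler_pdivrMr ?dist0// ler_peMr ?dist// ltW.
pose k z := g z / (1 + V z) * Q z ^+ n.
(* Here [Re (V z) >= cabs (g z)] is used. The bound [1] makes [k] bounded; the bound [cabs (g z)]
   makes it small near the interval. *)
have gV z : x0 < complex.Re z -> cabs (g z / (1 + V z)) <= Num.min 1 (cabs (g z)).
  move=> xz; have p1 := V1 z xz; have p2 := Vgt0 z xz; have p3 := cabs_ge0 (g z).
  rewrite cabsM cabsV le_min !ler_pdivrMr// mul1r; apply/andP; split.
    by apply: le_trans p1; rewrite lerDr.
  by rewrite ler_peMr//; apply: le_trans p1; rewrite lerDl.
have h0 y : 0 <= h y by rewrite le_min ler01 cabs_ge0.
have mD : measurable (D : set (measurableTypeR R)) by exact: measurable_itv.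
have ih : mu.-integrable D (EFin \o h).
  apply: (le_integrable _ _ _ (integrable_cst_itv (y0 - eta) (y0 + eta) 1)) => //.
    apply/measurable_EFinP; apply: measurable_funTS; apply: measurable_minr => //.
    by apply: continuous_measurable_fun; apply: H1_rhp_line_continuous => //; exact: lt_trans x02.
  by move=> y _ /=; rewrite lee_fin !ger0_norm ?h0// ge_min lexx.
have ich : mu.-integrable D (EFin \o (fun y => c ^+ n * h y)).
  exact: (integrableZl mD (c ^+ n) ih).
have kw : cabs (k w) <= 1 + (complex.Re w - 2 * x0)^-1 *
    \int[mu]_y ((fun y => c ^+ n * h y) \_ D) y.
  apply: (@poisson_le_one_add k x0 (c ^+ n)) => //.
  - move=> z xz; have z0 := pos z xz; apply: cdiffM; last first.
      apply: cdiffX; apply: cdiff_div; [|exact: cdiff_cst|].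
        by rewrite -cabs_gt0 dist0.
      by apply: cdiffD; [exact: cdiff_subr|exact: cdiff_cst].
    apply: cdiff_div; [by rewrite -cabs_gt0 Vgt0|exact: H1_rhp_cdiff|].
    apply: cdiffD; first exact: cdiff_cst.
    exact: cauchy_transform_cdiff.
  - move=> z xz; have z0 := pos z xz; rewrite cabsM -[leRHS]mul1r.
    apply: ler_pM; rewrite ?cabs_ge0//.
      by apply: (le_trans (gV z xz)); rewrite ge_min lexx.
    by rewrite cabsX lerXn2r ?nnegrE ?cabs_ge0 ?(ltW c0) ?Qc.
  - by move=> y; rewrite patchE; case: ifP => // _; rewrite mulr_ge0 ?exprn_ge0 ?(ltW c0).
  - have := (integrable_mkcond _ mD).1 ich.
    by apply: eq_integrable => // y _; rewrite /= !patchE; case: ifP.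
  - move=> y; have x20 : 0 < 2 * x0 by rewrite mulr_gt0.
    have hk : cabs (k (Complex (2 * x0) y)) <= h y * cabs (Q (Complex (2 * x0) y)) ^+ n.
      by rewrite cabsM cabsX ler_wpM2r ?exprn_ge0 ?cabs_ge0// gV.
    apply: (le_trans hk); rewrite patchE; case: ifPn => [_|yD].
      apply: (@le_trans _ _ (h y * c ^+ n)); last by rewrite mulrC lerDr.
      by rewrite ler_wpM2l// lerXn2r ?nnegrE ?cabs_ge0 ?(ltW c0)// Qc.
    rewrite addr0 -[leRHS]mulr1 ler_pM ?exprn_ge0 ?cabs_ge0//.
      by rewrite ge_min lexx.
    rewrite exprn_ile1 ?cabs_ge0// QE ler_pdivrMr ?dist0// mul1r.
    rewrite -(ler_pXn2r (n := 2)) ?nnegrE ?cabs_ge0 ?(ltW c0)//.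
    apply: le_trans (dist1 (Complex (2 * x0) y) x20); rewrite c2 lerD2l /=.
    rewrite -(real_normK (num_real (y - y0))) lerXn2r ?nnegrE ?(ltW eta0)//.
    rewrite leNgt; apply: contra yD; rewrite ltr_norml => hy.
    by apply/mem_set; rewrite /D /= in_itv/=; clear -hy; lra.
have w0 : x0 < complex.Re w by exact: lt_trans xw.
rewrite mulrCA -RintegralZl//.
have -> : cabs (g w) * (c / cabs (w - Complex 0 y0 + 1)) ^+ n = cabs (1 + V w) * cabs (k w).
  rewrite /k cabsM cabsX QE cabsM cabsV; field.
  by rewrite !gt_eqF ?Vgt0// dist0// pos.
apply: ler_pM; rewrite ?cabs_ge0//.
  apply: (le_trans (ler_cabsD _ _)); rewrite cabs1 lerD2l mulrC.
  apply: (le_trans (cauchy_transform_bound cu u0 iu w0)).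
  by rewrite ler_wpM2l// invr_ge0 subr_ge0 ltW.
apply: (le_trans kw); rewrite lerD2l -Rintegral_mkcond; exact: lexx.
Qed.

(** Truncation at [1] supplies the dominating function. The abscissas are the lines [2 * x0] of
    [H1_interval_estimate] for [x0 = harmonic m]. *)
Lemma H1_interval_cvg g (p q : R) : H1_rhp g ->
  {ae mu, forall y, p <= y <= q -> cabs (g (Complex x y)) @[x --> 0^'+] --> (0 : R)} ->
  \int[mu]_(y in `[p, q]) Num.min 1 (cabs (g (Complex (2 * harmonic m) y))) @[m --> \oo] --> (0 : R).
Proof.
move=> hg h0.
have xgt0 m : 0 < 2 * @harmonic R m by rewrite mulr_gt0 ?harmonic_gt0.
have xcvg : 2 * @harmonic R m @[m --> \oo] --> (0 : R).
  by rewrite -(mulr0 2); apply: cvgMr; exact: cvg_harmonic.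
have mD : measurable (`[p, q] : set (measurableTypeR R)) by exact: measurable_itv.
pose h m y := Num.min 1 (cabs (g (Complex (2 * harmonic m) y))).
have hge0 m y : 0 <= h m y by rewrite le_min ler01 cabs_ge0.
have [|||||_ _] := @dominated_convergence _ _ R mu _ mD
    (fun m y => (h m y)%:E) (cst 0%E) (cst 1%E).
- move=> m; apply/measurable_EFinP; apply: measurable_funTS; apply: measurable_minr => //.
  by apply: continuous_measurable_fun; exact: H1_rhp_line_continuous.
- exact: measurable_cst.
- apply: (negligibleS _ h0) => y /=; apply: contra_not => hy; rewrite in_itv/= => /hy{}hy.
  apply: cvg_EFin; first by apply: nearW.
  have /cvg_at_rightP hx := hy.
  have {}hx : cabs (g (Complex (2 * harmonic m) y)) @[m --> \oo] --> (0 : R) by apply: hx.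
  apply: (squeeze_cvgr _ (cvg_cst (0 : R)) hx).
  by apply: nearW => m; rewrite hge0 ge_min lexx orbT.
- exact: integrable_cst_itv.
- by apply: aeW => y m _; rewrite /= lee_fin ger0_norm// ge_min lexx.
rewrite integral0 => /fine_cvgP[_]; exact.
Qed.

(** In [H1_interval_estimate], [x0] tends to [0] for each fixed [n], leaving a bound independent of
    [n]. Where the base of the [n]-th power exceeds [1], namely near the midpoint of the interval,
    [g] must vanish. *)
Lemma H1_boundary_uniqueness g (p q : R) : H1_rhp g -> p < q ->
  {ae mu, forall y, p <= y <= q -> cabs (g (Complex x y)) @[x --> 0^'+] --> (0 : R)} ->
  forall w, 0 < complex.Re w -> g w = 0.
Proof.
move=> hg pq h0; have [M M0 hM] := H1_rhp_bound hg.
pose y0 := (p + q) / 2; pose eta := (q - p) / 2.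
have eta0 : 0 < eta by rewrite divr_gt0// subr_gt0.
pose c := Num.sqrt (1 + eta ^+ 2).
have c1 : 1 < c by rewrite -sqrtr1 ltr_sqrt ?ltrDl ?exprn_gt0// addr_gt0// exprn_gt0.
have c0 : 0 < c by apply: lt_trans c1.
have hp : y0 - eta = p by rewrite /y0 /eta; field.
have hq : y0 + eta = q by rewrite /y0 /eta; field.
have hJ := H1_interval_cvg hg h0.
have near0 w : 0 < complex.Re w -> cabs (w - Complex 0 y0 + 1) < c -> g w = 0.
  move=> w0 wc; apply/eqP/negP => /negP; rewrite -cabs_gt0 => gw.
  have dw : 0 < cabs (w - Complex 0 y0 + 1).
    apply: lt_le_trans (ler_Re_cabs _); rewrite ReD ReB /= subr0.
    by rewrite normr_gt0 gt_eqF// addr_gt0.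
  suff : c / cabs (w - Complex 0 y0 + 1) <= 1.
    by rewrite ler_pdivrMr// mul1r leNgt wc.
  set a := complex.Re w in w0.
  apply: (@ler_of_expr R _ _ (1 + 2 * M / a) (cabs (g w))) => // n.
  rewrite expr1n mul1r mulrC; apply/ler_addgt0Pr => e e0.
  pose K := (1 + 2 * M / a) * (c ^+ n * (2 / a)).
  have B0 : 0 <= 1 + 2 * M / a by rewrite addr_ge0// divr_ge0 ?mulr_ge0// ltW.
  have K0 : 0 < K + 1.
    by rewrite ltr_wpDl// mulr_ge0// mulr_ge0 ?exprn_ge0 ?divr_ge0// ltW.
  (* The first condition makes [a - x0] and [a - 2 x0] at least [a / 2], which is where the factors
     [2 / a] in [K] come from. *)
  have [m [hm1 hm2]] : exists m, 4 * harmonic m < a /\ (K + 1) * \int[mu]_(y in `[p, q])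
      Num.min 1 (cabs (g (Complex (2 * harmonic m) y))) < e.
    have /cvgrPdist_lt/(_ (a / 4)) := @cvg_harmonic R.
    rewrite divr_gt0// => /(_ isT) hx.
    move/cvgrPdist_lt: hJ => /(_ (e / (K + 1))); rewrite divr_gt0// => /(_ isT) hJ.
    have [m [h1 h2]] := @filter_ex _ _ _ _ (filterI hx hJ).
    exists m; split.
      move: h1; rewrite sub0r normrN ger0_norm ?harmonic_ge0// ltr_pdivlMr// mulrC; exact.
    move: h2; rewrite sub0r normrN ltr_pdivlMr// mulrC; apply: le_lt_trans.
    by rewrite ler_wpM2l ?(ltW K0)// ler_norm.
  set J := \int[mu]_(y in _) _ in hm2.
  have J0 : 0 <= J.
    by apply: Rintegral_ge0 => y _; rewrite le_min ler01 cabs_ge0.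
  have x0 : 0 < @harmonic R m by exact: harmonic_gt0.
  have x2 : 2 * harmonic m < a by clear -hm1 x0; lra.
  have := H1_interval_estimate y0 n hg x0 eta0 x2 (hM _ x0).
  rewrite hp hq -/c -/J -/a => h; apply: (le_trans h).
  apply: (@le_trans _ _ ((1 + 2 * M / a) * (1 + c ^+ n * (2 / a * J)))).
    apply: ler_pM.
    - by rewrite addr_ge0// divr_ge0// subr_ge0 ltW// (lt_trans _ x2)// mulr_natl mulr2n ltrDl.
    - rewrite addr_ge0// mulr_ge0 ?exprn_ge0 ?(ltW c0)//.
      by rewrite mulr_ge0// invr_ge0 subr_ge0 ltW.
    - rewrite lerD2l (mulrC 2) -mulrA ler_wpM2l//.
      rewrite -[2]invrK -invfM lef_pV2 ?posrE ?mulr_gt0 ?invr_gt0 ?subr_gt0//;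
      by clear -hm1 x0; lra.
    rewrite lerD2l ler_wpM2l ?exprn_ge0 ?(ltW c0)// ler_wpM2r//.
    rewrite -[2 in leRHS]invrK -invfM lef_pV2 ?posrE ?mulr_gt0 ?invr_gt0 ?subr_gt0//.
    by clear -hm1 x0; lra.
  rewrite mulrDr mulr1 lerD2l mulrA mulrA -/K; apply: (le_trans _ (ltW hm2)).
  by rewrite ler_wpM2r// -[leLHS]mulrA -/K lerDl.
(* At [r + i (y0 + t)] with [0 < t < r] the modulus in [near0] is at most
   [1 + r + t < 1 + 2 r = c]. *)
pose r := (c - 1) / 2; have r0 : 0 < r by rewrite divr_gt0// subr_gt0.
move=> w w0; apply: (@rhp_identity _ g (Complex r y0) w r) => //.
  exact: H1_rhp_locbounded.
move=> t /andP[t0 tr]; apply: near0 => //=; apply: (le_lt_trans (ler_cabs_ReIm _)).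
rewrite ReD ImD ReB ImB /= addr0 subr0 addrAC subrr add0r !gtr0_norm ?addr_gt0//.
by move: tr; rewrite /r; clear; lra.
Qed.

End BoundaryUniqueness.

(** * From the imaginary axis to the line [Re z = 2 s], and periodicity of the quotient *)

Section BoundaryModulus.
Context {R : realType}.
Notation mu := (@lebesgue_measure R).
Implicit Types (f g : R[i] -> R[i]) (z w : R[i]).

Lemma cvg_cabs (F : set_system R) (FF : Filter F) (h : R -> R[i]) (a : R[i]) :
  (h x : R[i]^o) @[x --> F] --> (a : R[i]^o) -> cabs (h x) @[x --> F] --> cabs a.
Proof.
move=> ha; apply/cvgrPdist_lt => e e0.
move/cvgrPdist_lt : ha => /(_ e%:C%C); rewrite ltcR => /(_ e0); apply: filterS => x.
rewrite normcE_cabs ltcR; apply: le_lt_trans; rewrite ler_norml.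
have := lerB_cabsB a (h x); have := lerB_cabsB (h x) a; rewrite (cabsC (h x)).
by move: (cabs (a - _)) => u; clear; lra.
Qed.

Lemma cdiff_cvg_cabs f (s y : R) : cdiff f (Complex s y) ->
  cabs (f (Complex (s - x) y)) @[x --> 0^'+] --> cabs (f (Complex s y)).
Proof.
move=> df; apply/cvgrPdist_lt => e e0; have [d d0 hd] := cdiff_continuous df e0.
near=> x; have x0 : 0 < x by near: x; exact: nbhs_right_gt.
have xd : x < d by near: x; exact: nbhs_right_lt.
have := hd (Complex (s - x) y); rewrite cabs_horizontal addrAC subrr add0r normrN gtr0_norm//.
move=> /(_ xd); apply: le_lt_trans; rewrite ler_norml.
have := lerB_cabsB (f (Complex s y)) (f (Complex (s - x) y)).
have := lerB_cabsB (f (Complex (s - x) y)) (f (Complex s y)).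
rewrite (cabsC (f (Complex s y))).
by move: (cabs (_ - _)) (cabs _) (cabs _) => u v u'; clear; lra.
Unshelve. all: by end_near. Qed.

Lemma cdiff_cabs_neq f g (s y : R) : cdiff f (Complex s y) -> cdiff g (Complex s y) ->
  cabs (f (Complex s y)) <> cabs (g (Complex s y)) ->
  exists2 d, 0 < d & forall y', y - d <= y' <= y + d ->
    cabs (f (Complex s y')) <> cabs (g (Complex s y')).
Proof.
move=> df dg /eqP; set F := cabs (f _); set G := cabs (g _); rewrite -subr_eq0 -normr_gt0 => FG.
have e0 : 0 < `|F - G| / 2 by rewrite divr_gt0.
have [d1 d10 h1] := cdiff_continuous df e0; have [d2 d20 h2] := cdiff_continuous dg e0.
have [|d d0 /= /and3P[dd1 dd2 _]] := @exists_small R [:: d1 / 2; d2 / 2].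
  by rewrite /= !divr_gt0.
exists d => // y' hy E.
have yd : `|y' - y| <= d by rewrite ler_norml; clear -hy; lra.
have := h1 (Complex s y'); have := h2 (Complex s y'); rewrite !cabs_vertical.
have lt1 : `|y' - y| < d1 by apply: (le_lt_trans yd); clear -dd1 d10; lra.
have lt2 : `|y' - y| < d2 by apply: (le_lt_trans yd); clear -dd2 d20; lra.
move=> /(_ lt2) k2 /(_ lt1) k1.
have a1 := lerB_cabsB (f (Complex s y')) (f (Complex s y)).
have a2 := lerB_cabsB (f (Complex s y)) (f (Complex s y')).
have b1 := lerB_cabsB (g (Complex s y')) (g (Complex s y)).
have b2 := lerB_cabsB (g (Complex s y)) (g (Complex s y')).
rewrite (cabsC (f (Complex s y))) -/F in a2; rewrite (cabsC (g (Complex s y))) -/G in b2.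
rewrite -/F E in a1; rewrite E in a2; rewrite -/G in b1.
have : `|F - G| <= cabs (f (Complex s y') - f (Complex s y)) + cabs (g (Complex s y') - g (Complex s y)).
  move: a1 a2 b1 b2; rewrite ler_norml.
  by move: (cabs (_ - _)) (cabs (_ - _)) (cabs _) => u v r; clear; lra.
by move: k1 k2; move: `|_| (cabs _) (cabs _) => D u v; clear; lra.
Qed.

(* Reflection in the line [Re z = s] turns equality of the moduli of the boundary
   values into equality on [Re z = 2 s], except where the boundary values vanish. *)
Lemma abs_eq_double_line f g (s : R) : H1_rhp f -> H1_rhp g ->
  {ae mu, forall y : R, exists a b : R[i],
     ((f (Complex x y) : R[i]^o) @[x --> 0^'+] --> (a : R[i]^o)) /\
     ((g (Complex x y) : R[i]^o) @[x --> 0^'+] --> (b : R[i]^o)) /\ cabs a = cabs b} ->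
  0 < s -> (forall y, cabs (f (Complex s y)) = cabs (g (Complex s y))) ->
  forall y, cabs (f (Complex (2 * s) y)) = cabs (g (Complex (2 * s) y)).
Proof.
move=> hf hg h0 s0 hs y; have bf := H1_rhp_locbounded hf; have bg := H1_rhp_locbounded hg.
apply: contrapT => fg; have s20 : 0 < 2 * s by rewrite mulr_gt0.
have df y' : cdiff f (Complex (2 * s) y') by exact: bf.1.
have dg y' : cdiff g (Complex (2 * s) y') by exact: bg.1.
have [d d0 hd] := cdiff_cabs_neq (df y) (dg y) fg.
have hab y' : y - d <= y' <= y + d -> (exists a b : R[i],
     ((f (Complex x y') : R[i]^o) @[x --> 0^'+] --> (a : R[i]^o)) /\
     ((g (Complex x y') : R[i]^o) @[x --> 0^'+] --> (b : R[i]^o)) /\ cabs a = cabs b) ->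
    cabs (f (Complex x y')) @[x --> 0^'+] --> (0 : R) /\
    cabs (g (Complex x y')) @[x --> 0^'+] --> (0 : R).
  move=> /hd hy' [a [b [/cvg_cabs fa [/cvg_cabs gb ab]]]].
  have Fa := @cvgM R R _ (@at_right_proper_filter R 0) _ _ _ _ fa (cdiff_cvg_cabs (df y')).
  have Gb := @cvgM R R _ (@at_right_proper_filter R 0) _ _ _ _ gb (cdiff_cvg_cabs (dg y')).
  (* The limit of the reflection identity at [x + i y'] as [x] tends to [0], when the mirror image
     tends to [2 s + i y']. As the moduli differ at that point, [cabs a = cabs b] must be [0]. *)
  have E : cabs a * cabs (f (Complex (2 * s) y')) = cabs b * cabs (g (Complex (2 * s) y')).
    apply: (@cvg_unique _ (@Rhausdorff R) _ _ _ _ Fa); apply: cvg_trans Gb; apply: near_eq_cvg.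
    near=> x; have x0 : 0 < x by near: x; exact: nbhs_right_gt.
    have xs : x < 2 * s by near: x; exact: nbhs_right_lt.
    have := reflection_eq bf bg s0 hs (z := Complex x y') x0 xs.
    have -> : (2 * s)%:C%C - conjc (Complex x y') = Complex (2 * s - x) y'.
      by apply/eqP; rewrite eq_complex /= opprK add0r !eqxx.
    by move=> /(congr1 (@cabs R)); rewrite !cabsM !cabs_conj /= => ->.
  suff a0 : cabs a = 0 by rewrite -{2}a0 ab in fa gb *; rewrite -ab a0 in fa gb *.
  apply: contrapT => /eqP a0; apply: hy'; apply: (mulfI a0).
  by rewrite E ab.
(* The moduli on [Re z = 2 s] differ at a whole interval of heights, so both functions have zero
   boundary values almost everywhere there and vanish identically, against [fg]. *)
have f0 : forall w, 0 < complex.Re w -> f w = 0.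
  apply: (@H1_boundary_uniqueness _ f (y - d) (y + d)) => //; first by clear -d0; lra.
  by apply: (negligibleS _ h0) => y' /=; apply: contra_not => h /hab []; [exact: h|].
have g0 : forall w, 0 < complex.Re w -> g w = 0.
  apply: (@H1_boundary_uniqueness _ g (y - d) (y + d)) => //; first by clear -d0; lra.
  by apply: (negligibleS _ h0) => y' /=; apply: contra_not => h /hab []; [exact: h|].
by apply: fg; rewrite f0// g0.
Unshelve. all: by end_near. Qed.

(** Reflection in [Re z = s] followed by reflection in [Re z = 2 s] is translation by [2 s]. *)
Lemma quotient_periodic f g (s y0 : R) : rhp_locbounded f -> rhp_locbounded g -> 0 < s ->
  (forall y, cabs (f (Complex s y)) = cabs (g (Complex s y))) ->
  (forall y, cabs (f (Complex (2 * s) y)) = cabs (g (Complex (2 * s) y))) ->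
  g (Complex s y0) != 0 ->
  forall j z, 0 < complex.Re z ->
    f z * g (z + (2 * s * j%:R)%:C%C) = f (z + (2 * s * j%:R)%:C%C) * g z.
Proof.
move=> bf bg s0 hs h2s gy0; have s20 : 0 < 2 * s by rewrite mulr_gt0.
have sh t h : 0 <= t -> rhp_locbounded h -> rhp_locbounded (fun z : R[i] => h (z + t%:C%C)).
  exact: rhp_locbounded_shift.
have step z : 0 < complex.Re z -> f z * g (z + (2 * s)%:C%C) = f (z + (2 * s)%:C%C) * g z.
  move=> z0; apply/eqP; rewrite -subr_eq0; apply/eqP.
  apply: (@rhp_identity R (fun z => f z * g (z + (2 * s)%:C%C) - f (z + (2 * s)%:C%C) * g z)
    (Complex s 0) z 1) => //.
    by apply: rhp_locboundedB; apply: rhp_locboundedM => //; apply: sh => //; exact: ltW.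
  move=> t _ /=; set w := Complex s _; set w2 := w + _.
  have := reflection_eq bf bg s20 h2s (z := w2).
  have -> : complex.Re w2 = 3 * s by rewrite /w2 ReD /=; clear; lra.
  have -> : (2 * (2 * s))%:C%C - conjc w2 = w.
    apply/eqP; rewrite eq_complex /=; apply/andP; split; apply/eqP; clear; lra.
  have h3 : 0 < 3 * s by rewrite mulr_gt0.
  have h4 : 3 * s < 2 * (2 * s) by clear -s0; lra.
  move=> /(_ h3 h4) E.
  have [gw|gw] := eqVneq (g w) 0.
    have fw : f w = 0 by apply/eqP; rewrite -cabs_eq0 hs -/w gw cabs0.
    by rewrite fw gw mul0r mulr0 subrr.
  have N : f w * conjc (f w) = g w * conjc (g w) by rewrite !mulc_conj hs.
  have gcw : g w * conjc (g w) != 0 by rewrite mulf_neq0// conjc_eq0.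
  apply: (mulIf gcw); rewrite mul0r mulrBl.
  rewrite (_ : f w * g w2 * _ = f w * g w * (g w2 * conjc (g w))); last by ring.
  rewrite (_ : f w2 * g w * _ = g w * f w2 * (g w * conjc (g w))); last by ring.
  by rewrite -N -E; ring.
elim=> [|j IH] z z0; first by rewrite mulr0 addr0.
pose t := 2 * s * j%:R; have t0 : 0 <= t by rewrite mulr_ge0// ltW.
have E : 2 * s * j.+1%:R = t + 2 * s by rewrite -[j.+1%:R]natr1 mulrDr mulr1.
have t10 : 0 <= t + 2 * s by rewrite addr_ge0// ltW.
rewrite E; apply/eqP; rewrite -subr_eq0; apply/eqP.
(* Chaining the induction hypothesis with one more step produces an extra factor [g (z + t)]. It may
   have zeros, so it is cancelled as a function that is not identically zero. *)
apply: (@rhp_mul_eq0 R (fun z => f z * g (z + (t + 2 * s)%:C%C) - f (z + (t + 2 * s)%:C%C) * g z)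
  (fun z => g (z + t%:C%C))) => //.
- by apply: rhp_locboundedB; apply: rhp_locboundedM => //; exact: sh.
- exact: sh.
- move=> w w0 /=; have wt : 0 < complex.Re (w + t%:C%C) by rewrite ReD ltr_pwDl.
  have := step _ wt; have := IH w w0; rewrite -/t.
  have -> : w + (t + 2 * s)%:C%C = w + t%:C%C + (2 * s)%:C%C by rewrite rmorphD addrA.
  move: (g (_ + t%:C%C)) (f (_ + t%:C%C)) (f (_ + _ + _)) (g (_ + _ + _)) => a b a' b' h1 h2.
  rewrite mulrBl mulrAC h1 (_ : b * g w * b' = g w * (b * b')); first rewrite h2; ring.
- apply: contrapT => h; have g0 w : 0 < complex.Re w -> g (w + t%:C%C) = 0.
    by move=> w0; apply/eqP/negPn/negP => gw; apply: h; exists w.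
  move/negP: gy0; apply; apply/eqP.
  (* If [g (z + t)] vanished for all [z], then [g] would vanish on the line [Re z = s + t], hence at
     [s + i y0]. *)
  apply: (@rhp_identity R g (Complex (s + t) 0) _ 1) => //=; first by rewrite ltr_pwDl.
  move=> y _; have -> : Complex (s + t) (0 + y) = Complex s y + t%:C%C.
    by apply/eqP; rewrite eq_complex /= add0r addr0 !eqxx.
  exact: g0.
Qed.

End BoundaryModulus.

Theorem theorem2p13 (R : realType) (f g : R[i] -> R[i]) :
  H1_rhp f -> H1_rhp g ->
  (* |f| = |g| a.e. on iR, in the sense of (radial) boundary values *)
  {ae @lebesgue_measure R, forall y : R,
     exists a b : R[i],
       ((f (Complex x y) : R[i]^o) @[x --> 0^'+] --> (a : R[i]^o)) /\
       ((g (Complex x y) : R[i]^o) @[x --> 0^'+] --> (b : R[i]^o)) /\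
       cabs a = cabs b} ->
  (* |f| = |g| on 1 + iR *)
  (forall y : R, cabs (f (Complex 1 y)) = cabs (g (Complex 1 y))) ->
  exists c : R[i], cabs c = 1 /\ forall z : R[i], 0 < complex.Re z -> f z = c * g z.
Proof.
move=> hf hg hfg0 hfg1.
have bf := H1_rhp_locbounded hf; have bg := H1_rhp_locbounded hg.
have hfg2 := abs_eq_double_line hf hg hfg0 ltr01 hfg1.
have [[y0 gy0]|] := pselect (exists y, g (Complex 1 y) != 0); last first.
  move=> g0; exists 1; split; first exact: cabs1.
  have {}g0 y : g (Complex 1 y) = 0.
    by apply/eqP/negPn/negP => gy; apply: g0; exists y.
  have f0 y : f (Complex 1 y) = 0 by apply/eqP; rewrite -cabs_eq0 hfg1 g0 cabs0.
  (* Here [f] and [g] both vanish on [Re z = 1], hence everywhere, and [c = 1] serves. *)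
  by move=> z z0; rewrite (@rhp_identity _ f (Complex 1 0) z 1)// (@rhp_identity _ g (Complex 1 0) z 1)// mulr0.
pose z0 := Complex 1 y0 : R[i]; have z00 : 0 < complex.Re z0 by [].
have per := quotient_periodic bf bg ltr01 hfg1 hfg2 gy0.
(* The point [z0] lies on [Re z = 1], where the moduli agree, so [c] is unimodular; periodicity
   repeats the value [c] of the quotient, in cross-multiplied form, along [z0 + 2 j]. *)
pose c := f z0 / g z0.
have c1 : cabs c = 1 by rewrite cabsM cabsV hfg1 divff// cabs_eq0.
exists c; split=> // z hz; apply/eqP; rewrite -subr_eq0; apply/eqP.
apply: (@rhp_arithmetic_progression R (fun z => f z - c * g z) z0) => //.
  by apply: rhp_locboundedB => //; exact: rhp_locboundedZ.
move=> j /=; have := per j z0 z00.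
rewrite mulr1 => E; apply/eqP; rewrite subr_eq0 /c mulrAC; apply/eqP.
by rewrite E mulfK.
Qed.
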